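(* Let $\phi=\frac{1+\sqrt5}{2}$. Then \[\lim_{g\to\infty}\frac{1}{g^4}\mathbb{E}_g[w(S)^2]=\left(\frac{1}{10\phi}\right)^2.\]
   Context: A numerical semigroup $S$ is a submonoid of $\mathbb{N}_0$ with finite complement $\mathcal{H}(S)$; its genus is $g=|\mathcal{H}(S)|$. The weight is $w(S)=\left(\sum_{x\in\mathcal{H}(S)}x\right)-\frac{g(g+1)}{2}$. $\mathcal{S}_g$ is the set of numerical semigroups of genus $g$ and $\mathbb{E}_g$ denotes expectation with respect to the uniform distribution on $\mathcal{S}_g$. *)

(* Defs.v *)
From Stdlib Require Import Reals.
From mathcomp Require Import all_boot.

Set Implicit Arguments. Unset Strict Implicit. Unset Printing Implicit Defensive.

(* A numerical semigroup S of genus g is encoded by its gap set H(S) = N \ S.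
   Every gap of a numerical semigroup of genus g is < 2g (standard fact), so
   gap sets of genus-g semigroups are exactly the subsets H of {0,...,2g-1}
   with #|H| = g whose complement in N is a submonoid of N. *)

Definition isgap (g : nat) (H : {set 'I_(2 * g)}) (n : nat) : bool :=
  [exists z in H, nat_of_ord z == n].

(* the complement S = N \ H is a submonoid of (N,+): 0 \in S and S closed under +.
   (Closure only needs to be checked for x, y < 2g: elements >= 2g are never gaps.) *)
Definition is_semigroup_gapset (g : nat) (H : {set 'I_(2 * g)}) : bool :=
  ~~ isgap H 0 &&
  [forall x : 'I_(2 * g), forall y : 'I_(2 * g),
     (~~ isgap H x) ==> (~~ isgap H y) ==> (~~ isgap H (x + y))].

Definition NS (g : nat) : {set {set 'I_(2 * g)}} :=
  [set H : {set 'I_(2 * g)} | (#|H| == g) && is_semigroup_gapset H].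

(* weight w(S) = (sum of gaps) - g(g+1)/2  (always a nonnegative integer) *)
Definition weight (g : nat) (H : {set 'I_(2 * g)}) : nat :=
  (\sum_(x in H) nat_of_ord x) - (g * g.+1) %/ 2.

Definition Ew2 (g : nat) : R :=
  Rdiv (INR (\sum_(H in NS g) expn (weight H) 2)) (INR #|NS g|).

Definition phi : R := Rdiv (Rplus 1 (sqrt 5)) 2.

(* Main.v *)
(** Write z = 1/phi and describe a semigroup of multiplicity m by its Kunz
    coordinates k_1, ..., k_{m-1} >= 1, where i + k_i m is the least element
    congruent to i; their sum is the genus. Since z + z^2 = 1, giving a
    coordinate vector the weight z^(k_1 + ... + k_{m-1}) turns the semigroups
    with all k_i in {1, 2} into sequences of independent random variables, for
    which a Chernoff bound gives m ~ g / (1 + z^2) and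
    w ~ g^2 z / 10 outside a set of exponentially small weight. There are at least
    z phi^g semigroups of genus g, so every family of size O(phi^g e^(-cg)) can be
    ignored, and w <= 2 g^2 makes convergence in probability sufficient.

    Semigroups with a positive proportion of k_i >= 3 are exponentially rare:
    k_{i+j} <= k_i + k_j and k_{i+j-m} <= k_i + k_j + 1 forbid small values at
    both ends of every pair reflected through a large coordinate. One coordinate
    k_r >= 7 is enough. For q in {3, ..., 6}, if there are many k_i >= q but few
    k_i > q, some bounded window contains four coordinates >= q; the pairs
    reflected through them form a 4-regular bipartite graph, and Finner's
    inequality bounds the weight per vertex by that of K_{4,4}, which is less
    than 1. *)

Require Import Defs.
From Stdlib Require Import Reals.
From mathcomp Require Import all_boot all_order all_algebra.
From mathcomp Require Import boolp reals Rstruct sequences exp.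
From mathcomp Require Import ring lra zify.

Set Implicit Arguments. Unset Strict Implicit. Unset Printing Implicit Defensive.
Import Order.TTheory GRing.Theory Num.Theory.

Ltac nat_lia :=
  try match goal with
  | R : rcfType |- _ => clear dependent R
  | R : realType |- _ => clear dependent R
  end; lia.

(** * Weighted sums over coordinate vectors *)

Local Open Scope ring_scope.

(** A single reflection couples two coordinates, and the total weight of the pairs with sum at least
    [l] drops below 1 only at [l = 6]; a reflection that wraps around [m] loses one unit, whence the
    threshold 7. At lower levels several reflections must act together: at level 3 the weight of
    K_{2,2} is still about 1.02, while K_{4,4} stays safely below 1, and degree 4 needs only
    Cauchy-Schwarz applied twice. The lost unit shapes the rest. Below the window, reflected sums
    are at least [q] and values are mostly at most [q], which gains a constant factor per pair.
    Above it only sums at least [q - 1] are guaranteed. The gain comes from the part below the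
    window alone, whose length is a positive proportion of [m]. The constants are chosen upward in
    [q]: how rare values above [q] must be depends on the density of values at least [q]. *)

Definition upd (y : nat -> nat) (j v : nat) : nat -> nat :=
  fun i => if i == j then v else y i.

(* Total weight of [F] over all ways of giving values in [V] to the coordinates listed in [s]; the other coordinates are those of [y]. *)
Fixpoint msum (R : numDomainType) (c : nat -> nat -> R) (V s : seq nat)
    (F : (nat -> nat) -> R) (y : nat -> nat) : R :=
  if s is j :: s' then \sum_(v <- V) c j v * msum c V s' F (upd y j v) else F y.

Definition indep (T : Type) (F : (nat -> nat) -> T) (j : nat) :=
  forall y v, F (upd y j v) = F y.

Lemma upd_upd y j v w : upd (upd y j v) j w = upd y j w.
Proof. by apply/funext => i; rewrite /upd; case: eqP. Qed.

Lemma updC y i j v w : i != j -> upd (upd y j v) i w = upd (upd y i w) j v.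
Proof.
move=> ij; apply/funext => a; rewrite /upd.
by case: (eqVneq a i) => // ->; rewrite (negbTE ij).
Qed.

Lemma upd_same y j v : upd y j v j = v.
Proof. by rewrite /upd eqxx. Qed.

Lemma upd_other y i j v : i != j -> upd y j v i = y i.
Proof. by rewrite /upd => /negbTE ->. Qed.

Lemma indep_coord (T : Type) (f : nat -> T) i j : i != j -> indep (fun y => f (y i)) j.
Proof. by move=> ij y v; rewrite upd_other. Qed.

Lemma indep_msum (R : numDomainType) (c : nat -> nat -> R) V s F j :
  indep F j -> indep (msum c V s F) j.
Proof.
move=> Fj; elim: s => [//|i s IH] y v /=.
apply: eq_bigr => w _; congr (_ * _); have [->|ij] := eqVneq i j.
  by rewrite upd_upd.
by rewrite updC // IH.
Qed.

Lemma eq_msum (R : numDomainType) (c : nat -> nat -> R) V s F G y :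
  F =1 G -> msum c V s F y = msum c V s G y.
Proof.
move=> FG; elim: s y => [|i s IH] y /=; first exact: FG.
by apply: eq_bigr => v _; rewrite IH.
Qed.

Lemma eq_msum_weight (R : numDomainType) (c d : nat -> nat -> R) V s F y :
  {in s & V, forall j v, c j v = d j v} -> msum c V s F y = msum d V s F y.
Proof.
elim: s y => [//|i s IH] y cd /=.
rewrite big_seq [RHS]big_seq; apply: eq_bigr => v vV.
rewrite cd ?mem_head // IH // => j w js; apply: cd.
by rewrite in_cons js orbT.
Qed.

Lemma msum_cat (R : numDomainType) (c : nat -> nat -> R) V s t F y :
  msum c V (s ++ t) F y = msum c V s (msum c V t F) y.
Proof. by elim: s y => [//|i s IH] y /=; apply: eq_bigr => v _; rewrite IH. Qed.

Lemma ler_msum (R : numDomainType) (c : nat -> nat -> R) V s F G y :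
  {in s & V, forall j v, 0 <= c j v} -> (forall y, F y <= G y) ->
  msum c V s F y <= msum c V s G y.
Proof.
move=> c0 FG; elim: s y c0 => [//|i s IH] y c0 /=.
rewrite big_seq [leRHS]big_seq; apply: ler_sum => v vV.
rewrite ler_wpM2l ?c0 ?mem_head // IH // => j w js; apply: c0.
by rewrite in_cons js orbT.
Qed.

Lemma msum_ge0 (R : numDomainType) (c : nat -> nat -> R) V s F y :
  {in s & V, forall j v, 0 <= c j v} -> (forall y, 0 <= F y) ->
  0 <= msum c V s F y.
Proof.
move=> c0 F0; elim: s y c0 => [//|i s IH] y c0 /=.
rewrite big_seq; apply: sumr_ge0 => v vV.
rewrite mulr_ge0 ?c0 ?mem_head // IH // => j w js; apply: c0.
by rewrite in_cons js orbT.
Qed.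

Lemma msumZ (R : numDomainType) (c : nat -> nat -> R) V s F G y :
  (forall j, j \in s -> indep G j) ->
  msum c V s (fun y => G y * F y) y = G y * msum c V s F y.
Proof.
elim: s y => [//|i s IH] y Gs /=.
rewrite big_distrr /=; apply: eq_bigr => v _.
rewrite IH; last by move=> j js; apply: Gs; rewrite in_cons js orbT.
by rewrite Gs ?mem_head // mulrCA.
Qed.

Lemma msum_const (R : numDomainType) (c : nat -> nat -> R) V s a y :
  msum c V s (fun=> a) y = a * \prod_(j <- s) \sum_(v <- V) c j v.
Proof.
elim: s y => [|i s IH] y /=; first by rewrite big_nil mulr1.
rewrite big_cons mulrCA big_distrl /=.
by apply: eq_bigr => v _; rewrite IH.
Qed.

Lemma msumZl (R : numDomainType) (c : nat -> nat -> R) V s F a y :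
  msum c V s (fun y => a * F y) y = a * msum c V s F y.
Proof. exact: (@msumZ _ c V s F (fun=> a)). Qed.

(** The factor of [i] may also read coordinates outside [s]. This is how left vertices of a
    bipartite graph see their right neighbours while being summed out independently. *)
Lemma msum_prod (R : numDomainType) (c : nat -> nat -> R) V s
    (h : nat -> nat -> (nat -> nat) -> R) y :
  uniq s -> (forall i v j, j \in s -> indep (h i v) j) ->
  msum c V s (fun y => \prod_(i <- s) h i (y i) y) y =
  \prod_(i <- s) \sum_(v <- V) c i v * h i v y.
Proof.
move=> us hs.
suff H t : {subset t <= s} -> uniq t -> forall y,
    msum c V t (fun y => \prod_(i <- t) h i (y i) y) y =
    \prod_(i <- t) \sum_(v <- V) c i v * h i v y by exact: H.
elim: t => [|i t IH] sub ut {}y; first by rewrite /= !big_nil.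
move: ut => /= /andP[it ut]; rewrite big_cons big_distrl /=.
apply: eq_bigr => v _; rewrite -mulrA; congr (_ * _).
have iS : i \in s by apply: sub; rewrite mem_head.
have tS : {subset t <= s} by move=> j jt; apply: sub; rewrite in_cons jt orbT.
have ih z : msum c V t (fun y => \prod_(j <- i :: t) h j (y j) y) z =
    msum c V t (fun y => h i (y i) y * \prod_(j <- t) h j (y j) y) z.
  by apply: eq_msum => z'; rewrite big_cons.
rewrite ih (@msumZ _ c V t _ (fun y => h i (y i) y)).
  rewrite upd_same hs // IH //; congr (_ * _).
  by apply: eq_bigr => j _; apply: eq_bigr => w _; rewrite hs.
move=> j jt z w; rewrite upd_other ?hs ?tS //.
by apply: contraNneq it => ->.
Qed.

Lemma msum_prod1 (R : numDomainType) (c : nat -> nat -> R) V s (h : nat -> nat -> R) y :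
  uniq s ->
  msum c V s (fun y => \prod_(i <- s) h i (y i)) y =
  \prod_(i <- s) \sum_(v <- V) c i v * h i v.
Proof. by move=> us; rewrite (@msum_prod _ c V s (fun i v _ => h i v)). Qed.

Lemma msum_scale (R : numDomainType) (c : nat -> nat -> R) V s F a y :
  msum (fun j v => a * c j v) V s F y = a ^+ size s * msum c V s F y.
Proof.
elim: s y => [|i s IH] y /=; first by rewrite mul1r.
rewrite exprS big_distrr /=; apply: eq_bigr => v _.
by rewrite IH mulrACA.
Qed.

Lemma msum_weight (R : numDomainType) (c : nat -> nat -> R) V s F y : uniq s ->
  msum (fun _ _ => 1) V s (fun y => \prod_(i <- s) c i (y i) * F y) y = msum c V s F y.
Proof.
elim: s y F => [|i s IH] y F /=; first by rewrite big_nil mul1r.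
move=> /andP[it ut]; apply: eq_bigr => v _; rewrite mul1r.
rewrite -(IH _ _ ut) -msumZl.
transitivity (msum (fun _ _ => 1) V s (fun z => c i (z i) * (\prod_(j <- s) c j (z j) * F z)) (upd y i v)).
  by apply: eq_msum => z; rewrite big_cons mulrA.
rewrite msumZ ?upd_same ?msumZl //.
by move=> j js; apply: indep_coord; apply: contraNneq it => ->.
Qed.

(** No coordinate vector is counted twice, by injectivity. The induction on [s] sorts [X] by the
    value of the first coordinate; when [s] is empty, injectivity leaves at most one element, whose
    vector is [y]. *)
Lemma sum_le_msum (R : numDomainType) (T : eqType) (V s : seq nat) (X : seq T)
    (k : T -> nat -> nat) (F : (nat -> nat) -> R) y :
  uniq X -> (forall y, 0 <= F y) ->
  {in X & s, forall x j, k x j \in V} ->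
  {in X, forall x j, j \notin s -> k x j = y j} ->
  {in X &, forall x x', {in s, k x =1 k x'} -> x = x'} ->
  \sum_(x <- X) F (k x) <= msum (fun _ _ => 1) V s F y.
Proof.
move=> + F0; elim: s X y => [|j s IH] X y uX kV ky kinj.
  case: X uX kV ky kinj => [|x [|x' X]] uX kV ky kinj.
  - by rewrite big_nil.
  - rewrite big_cons big_nil addr0 /=.
    by have -> : k x = y by apply/funext => i; apply: ky; rewrite ?mem_head.
  - have : x = x' by apply: kinj; rewrite ?mem_head // in_cons mem_head orbT.
    by move=> e; move: uX; rewrite e /= mem_head.
rewrite /=.
have -> : \sum_(x <- X) F (k x) =
    \sum_(x <- X | k x j \in V) F (k x).
  rewrite big_seq_cond [RHS]big_seq_cond; apply: eq_bigl => x.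
  by case: (boolP (x \in X)) => //= xX; rewrite (kV x j) ?mem_head.
apply: (@le_trans _ _ (\sum_(v <- V) \sum_(x <- X | k x j == v) F (k x))).
  rewrite (exchange_big_dep predT) /= //; rewrite [leRHS]big_mkcond [leLHS]big_mkcond.
  apply: ler_sum => x _; case: ifP => [kxV|_]; last by apply: sumr_ge0.
  rewrite (big_rem _ kxV) /= eqxx lerDl; exact: sumr_ge0.
apply: ler_sum => v _; rewrite mul1r -big_filter.
apply: IH => //.
- exact: filter_uniq.
- move=> x i; rewrite mem_filter => /andP[_ xX] iS.
  by apply: kV => //; rewrite in_cons iS orbT.
- move=> x; rewrite mem_filter => /andP[/eqP kxv xX] i iS.
  have [->|ij] := eqVneq i j; first by rewrite upd_same.
  by rewrite upd_other //; apply: ky; rewrite // in_cons negb_or ij.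
- move=> x x'; rewrite !mem_filter => /andP[/eqP kx xX] /andP[/eqP kx' x'X] E.
  apply: kinj => // i; rewrite in_cons => /orP[/eqP ->|]; last exact: E.
  by rewrite kx kx'.
Qed.

Lemma weighted_sum_le_msum (R : numDomainType) (T : eqType) (V s : seq nat) (X : seq T)
    (k : T -> nat -> nat) (c : nat -> nat -> R) (F : (nat -> nat) -> R) y :
  uniq X -> uniq s -> (forall y, 0 <= F y) -> (forall j v, 0 <= c j v) ->
  {in X & s, forall x j, k x j \in V} ->
  {in X, forall x j, j \notin s -> k x j = y j} ->
  {in X &, forall x x', {in s, k x =1 k x'} -> x = x'} ->
  \sum_(x <- X) (\prod_(j <- s) c j (k x j)) * F (k x) <= msum c V s F y.
Proof.
move=> uX us F0 c0 kV ky kinj; rewrite -msum_weight //.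
apply: (@sum_le_msum _ _ V s X k (fun y => \prod_(j <- s) c j (y j) * F y)) => // z.
by rewrite mulr_ge0 // prodr_ge0.
Qed.

(** * Finner's inequality *)

(** Two nested square roots exist in every real closed field and match the proof of the four-factor
    Hölder inequality by iterated Cauchy-Schwarz. *)
Definition root4 (R : rcfType) (x : R) := Num.sqrt (Num.sqrt x).

Lemma root4_ge0 (R : rcfType) (x : R) : 0 <= root4 x.
Proof. exact: sqrtr_ge0. Qed.

Lemma root4K (R : rcfType) (x : R) : 0 <= x -> root4 x ^+ 4 = x.
Proof. by move=> x0; rewrite (exprM _ 2 2) sqr_sqrtr ?sqrtr_ge0 // sqr_sqrtr. Qed.

Lemma root4_1 (R : rcfType) : root4 (1 : R) = 1.
Proof. by rewrite /root4 !sqrtr1. Qed.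

Lemma le_root4 (R : rcfType) (x e : R) : 0 <= e -> x <= e ^+ 4 -> root4 x <= e.
Proof.
move=> e0 xe; rewrite /root4 -[leRHS](ger0_norm e0) -sqrtr_sqr ler_sqrt ?sqr_ge0 //.
rewrite -[leRHS](ger0_norm (sqr_ge0 e)) -sqrtr_sqr ler_sqrt; first by rewrite -exprM.
by rewrite exprn_ge0 ?sqr_ge0.
Qed.

Lemma cauchy_schwarz_weighted (R : rcfType) (T : Type) (V : seq T) (c a b : T -> R) :
  (forall v, 0 <= c v) ->
  (\sum_(v <- V) c v * (a v * b v)) ^+ 2 <=
  (\sum_(v <- V) c v * a v ^+ 2) * (\sum_(v <- V) c v * b v ^+ 2).
Proof.
move=> c0; elim: V => [|v V IH]; first by rewrite !big_nil mul0r expr0n.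
rewrite !big_cons.
set S := \sum_(j <- V) _ in IH *; set X := \sum_(j <- V) _ in IH *.
set Y := \sum_(j <- V) _ in IH *.
have X0 : 0 <= X by apply: sumr_ge0 => i _; rewrite mulr_ge0 ?sqr_ge0.
have Y0 : 0 <= Y by apply: sumr_ge0 => i _; rewrite mulr_ge0 ?sqr_ge0.
have := c0 v; move: (a v) (b v) (c v) S X Y IH X0 Y0 => p q d S X Y IH X0 Y0 d0.
have T0 : 0 <= X * q ^+ 2 + Y * p ^+ 2 by apply: addr_ge0; apply: mulr_ge0; rewrite ?sqr_ge0.
(* Compared after squaring: [S ^+ 2 <= X * Y] reduces the claim to [4 * X * Y * (p * q) ^+ 2 <= (X *
   q ^+ 2 + Y * p ^+ 2) ^+ 2], which is AM-GM. *)
have key : 2 * S * (p * q) <= X * q ^+ 2 + Y * p ^+ 2.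
  apply: (le_trans (ler_norm _)); rewrite -[leRHS]ger0_norm // -!sqrtr_sqr ler_wsqrtr //.
  have h : S ^+ 2 * (p * q) ^+ 2 <= X * Y * (p * q) ^+ 2 by rewrite ler_wpM2r ?sqr_ge0.
  have := sqr_ge0 (X * q ^+ 2 - Y * p ^+ 2); lra.
have : d * (2 * S * (p * q)) <= d * (X * q ^+ 2 + Y * p ^+ 2) by rewrite ler_wpM2l.
lra.
Qed.

Lemma cauchy_schwarz_sqrt (R : rcfType) (T : Type) (V : seq T) (c a b : T -> R) :
  (forall v, 0 <= c v) ->
  \sum_(v <- V) c v * (a v * b v) <=
  Num.sqrt (\sum_(v <- V) c v * a v ^+ 2) * Num.sqrt (\sum_(v <- V) c v * b v ^+ 2).
Proof.
move=> c0; apply: (le_trans (ler_norm _)); rewrite -sqrtr_sqr -sqrtrM; last first.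
  by apply: sumr_ge0 => i _; rewrite mulr_ge0 ?sqr_ge0.
rewrite ler_wsqrtr //; exact: cauchy_schwarz_weighted.
Qed.

Lemma holder4 (R : rcfType) (T : Type) (V : seq T) (p a1 a2 a3 a4 : T -> R) :
  (forall v, 0 <= p v) ->
  \sum_(v <- V) p v * (a1 v * a2 v * a3 v * a4 v) <=
  root4 (\sum_(v <- V) p v * a1 v ^+ 4) * root4 (\sum_(v <- V) p v * a2 v ^+ 4) *
  root4 (\sum_(v <- V) p v * a3 v ^+ 4) * root4 (\sum_(v <- V) p v * a4 v ^+ 4).
Proof.
move=> p0.
have cs a b : Num.sqrt (\sum_(v <- V) p v * (a v * b v) ^+ 2) <=
    root4 (\sum_(v <- V) p v * a v ^+ 4) * root4 (\sum_(v <- V) p v * b v ^+ 4).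
  rewrite /root4 -sqrtrM ?sqrtr_ge0 // ler_wsqrtr //.
  under eq_bigr => v _ do rewrite exprMn.
  apply: le_trans (cauchy_schwarz_sqrt _ _ _ p0) _.
  by under eq_bigr => v _ do rewrite -exprM; under [X in _ * Num.sqrt X]eq_bigr => v _ do rewrite -exprM.
under eq_bigr => v _ do rewrite -(mulrA (a1 v * a2 v)).
apply: le_trans (cauchy_schwarz_sqrt _ _ _ p0) _.
rewrite -[leRHS]mulrA; apply: ler_pM; rewrite ?sqrtr_ge0 ?cs //.
Qed.

(** Missing factors are filled up with the constant 1, whose norm is 1 because [p] has total mass
    1. *)
Lemma holder_le4 (R : rcfType) (T I : Type) (V : seq T) (p : T -> R) (J : seq I) (a : I -> T -> R) :
  (forall v, 0 <= p v) -> \sum_(v <- V) p v = 1 -> (size J <= 4)%N ->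
  \sum_(v <- V) p v * \prod_(t <- J) a t v <=
  \prod_(t <- J) root4 (\sum_(v <- V) p v * a t v ^+ 4).
Proof.
move=> p0 p1.
have one : root4 (\sum_(v <- V) p v * (fun=> 1) v ^+ 4) = 1.
  by under eq_bigr => v _ do rewrite expr1n mulr1; rewrite p1 root4_1.
case: J => [|t1 [|t2 [|t3 [|t4 [|//]]]]] _; rewrite ?big_nil.
- by under eq_bigr => v _ do rewrite big_nil mulr1; rewrite p1.
- apply: (@le_trans _ _ _ _ _ _ (le_trans (holder4 V (a t1) (fun=> 1) (fun=> 1) (fun=> 1) p0) _)).
    by apply: ler_sum => v _; rewrite !big_cons big_nil !mulr1 ?mulrA.
  by rewrite ?one !big_cons big_nil !mulr1 ?mulrA.
- apply: (@le_trans _ _ _ _ _ _ (le_trans (holder4 V (a t1) (a t2) (fun=> 1) (fun=> 1) p0) _)).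
    by apply: ler_sum => v _; rewrite !big_cons big_nil !mulr1 ?mulrA.
  by rewrite ?one !big_cons big_nil !mulr1 ?mulrA.
- apply: (@le_trans _ _ _ _ _ _ (le_trans (holder4 V (a t1) (a t2) (a t3) (fun=> 1) p0) _)).
    by apply: ler_sum => v _; rewrite !big_cons big_nil !mulr1 ?mulrA.
  by rewrite ?one !big_cons big_nil !mulr1 ?mulrA.
- apply: (@le_trans _ _ _ _ _ _ (le_trans (holder4 V (a t1) (a t2) (a t3) (a t4) p0) _)).
    by apply: ler_sum => v _; rewrite !big_cons big_nil !mulr1 ?mulrA.
  by rewrite ?one !big_cons big_nil !mulr1 ?mulrA.
Qed.

(** Induction on the coordinates. When [j] is summed out, the factors not depending on [j] leave the
    sum, and Hölder's inequality treats the at most four others. [dep] may overestimate the true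
    dependence. *)
Lemma finner4 (R : rcfType) (I : Type) (p : nat -> nat -> R) (V s : seq nat) (J : seq I)
    (F : I -> (nat -> nat) -> R) (dep : I -> pred nat) y :
  (forall j v, 0 <= p j v) -> (forall j, j \in s -> \sum_(v <- V) p j v = 1) ->
  (forall t y, 0 <= F t y) ->
  (forall t j, ~~ dep t j -> indep (F t) j) ->
  (forall j, j \in s -> (count (dep^~ j) J <= 4)%N) ->
  msum p V s (fun y => \prod_(t <- J) F t y) y <=
  \prod_(t <- J) root4 (msum p V s (fun y => F t y ^+ 4) y).
Proof.
move=> p0 + F0 Fi; elim: s y => [|j s IH] y p1 cnt.
  rewrite /=; elim: J {cnt} => [|t J IHJ]; first by rewrite !big_nil.
  rewrite !big_cons ler_pM //; first by apply: prodr_ge0.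
  rewrite /root4 (exprM _ 2 2) sqrtr_sqr ger0_norm ?sqr_ge0 //.
  by rewrite sqrtr_sqr ger0_norm.
pose A t v := msum p V s (fun y => F t y ^+ 4) (upd y j v).
have A0 t v : 0 <= A t v by apply: msum_ge0 => // z; rewrite exprn_ge0.
apply: (@le_trans _ _ (\sum_(v <- V) p j v * \prod_(t <- J) root4 (A t v))).
  rewrite /=; apply: ler_sum => v _; rewrite ler_wpM2l // IH //.
    by move=> i iS; apply: p1; rewrite in_cons iS orbT.
  by move=> i iS; apply: cnt; rewrite in_cons iS orbT.
have Aind t v : ~~ dep t j -> A t v = msum p V s (fun y => F t y ^+ 4) y.
  move=> dt; apply: indep_msum => z w; by rewrite Fi.
have Sind t : ~~ dep t j ->
    msum p V (j :: s) (fun y => F t y ^+ 4) y = msum p V s (fun y => F t y ^+ 4) y.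
  move=> dt; rewrite /=; under eq_bigr => v _ do rewrite -/(A t v) Aind //.
  by rewrite -big_distrl /= p1 ?mem_head // mul1r.
rewrite [leRHS](bigID (dep^~ j)) /=.
under eq_bigr => v _ do rewrite (bigID (dep^~ j)) /= mulrA.
have E v : \prod_(t <- J | ~~ dep t j) root4 (A t v) =
    \prod_(t <- J | ~~ dep t j) root4 (msum p V (j :: s) (fun y => F t y ^+ 4) y).
  by apply: eq_bigr => t dt; rewrite Aind // Sind.
under eq_bigr => v _ do rewrite E.
rewrite -big_distrl /= ler_wpM2r //; first by apply: prodr_ge0 => t _; exact: root4_ge0.
under eq_bigr => v _ do rewrite -big_filter.
have p1j : \sum_(v <- V) p j v = 1 by rewrite p1 ?mem_head.
have cj : (size [seq t <- J | dep t j] <= 4)%N by rewrite size_filter cnt ?mem_head.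
rewrite -[leRHS]big_filter; apply: le_trans (holder_le4 (fun t v => root4 (A t v)) (p0 j) p1j cj) _.
rewrite le_eqVlt; apply/orP; left; apply/eqP; apply: eq_bigr => t _.
by congr root4; apply: eq_bigr => v _; rewrite root4K.
Qed.

(** * Bipartite constraints *)

Lemma msum_sum (R : numDomainType) (c : nat -> nat -> R) V s (I : Type) (r : seq I)
    (F : I -> (nat -> nat) -> R) y :
  msum c V s (fun y => \sum_(a <- r) F a y) y = \sum_(a <- r) msum c V s (F a) y.
Proof.
elim: s y => [//|i s IH] y /=; rewrite exchange_big /=.
by apply: eq_bigr => v _; rewrite IH big_distrr.
Qed.

Definition upper_weight (R : numDomainType) (c : nat -> R) (V : seq nat) (a : nat) : R :=
  \sum_(v <- V) c v * (a <= v)%N%:R.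

Definition increment (R : zmodType) (g : nat -> R) (a : nat) : R :=
  g a - (if a is b.+1 then g b else 0).

(* [c v] is the weight of the value [v]; this is the total weight of the maps from the vertices of the complete bipartite graph K_{4,4} to [V] with [l <= v + w] along every edge, sorted by the minimum [a] on one side. *)
Definition biclique_weight (R : numDomainType) (c : nat -> R) (V : seq nat) (l N : nat) : R :=
  let g a := (\sum_(v <- V) c v * (l <= v + a)%N%:R) ^+ 4 in
  \sum_(a < N.+1) increment g a * upper_weight c V a ^+ 4.

(** Makes a function of a minimum [M] linear in the indicators [a <= M]. Each of these is a product
    over the coordinates entering the minimum, so it can be summed coordinate by coordinate. *)
Lemma telescope_indicator (R : numDomainType) (g : nat -> R) N M : (M <= N)%N ->
  \sum_(a < N.+1) increment g a * (a <= M)%N%:R = g M.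
Proof.
move=> MN.
rewrite -(big_mkord xpredT (fun a => increment g a * (a <= M)%N%:R)).
rewrite (big_cat_nat (n := M.+1)) //= [X in _ + X]big_nat_cond [X in _ + X]big1 ?addr0.
  rewrite big_nat_cond.
  rewrite (eq_bigr (increment g)); last first.
    by move=> a /andP[/andP[_ aM] _]; rewrite -ltnS aM mulr1.
  rewrite -big_nat_cond; elim: (M) => [|k IH]; first by rewrite big_nat1 /increment subr0.
  by rewrite big_nat_recr //= IH /increment addrCA subrr addr0.
by move=> a /andP[/andP[Ma _] _]; rewrite leqNgt Ma mulr0.
Qed.

Lemma leq_bigmin (I : Type) (rs : seq I) (N a : nat) (f : I -> nat) :
  (a <= \big[minn/N]_(r <- rs) f r)%N = (a <= N)%N && all (fun r => a <= f r)%N rs.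
Proof.
elim: rs => [|r rs IH]; first by rewrite big_nil andbT.
by rewrite big_cons leq_min IH /= andbCA.
Qed.

Lemma prodr_bool (R : numDomainType) (I : Type) (rs : seq I) (P : pred I) :
  \prod_(r <- rs) (P r)%:R = (all P rs)%:R :> R.
Proof.
elim: rs => [|r rs IH]; first by rewrite big_nil.
by rewrite big_cons IH /= -natrM mulnb.
Qed.

Lemma msum_prod_subset (R : numDomainType) (p : nat -> nat -> R) V s A (h : nat -> R) y :
  uniq s -> uniq A -> {subset A <= s} ->
  (forall j, j \in s -> \sum_(v <- V) p j v = 1) ->
  msum p V s (fun k => \prod_(j <- A) h (k j)) y = \prod_(j <- A) \sum_(v <- V) p j v * h v.
Proof.
move=> us uA As p1.
have pA : perm_eq A [seq j <- s | j \in A].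
  apply: uniq_perm; rewrite ?filter_uniq // => j; rewrite mem_filter.
  by case: (boolP (j \in A)) => // /As ->.
transitivity (msum p V s (fun k => \prod_(j <- s) if j \in A then h (k j) else 1) y).
  apply: eq_msum => k; rewrite -big_mkcond /= (perm_big _ pA) /= big_filter //.
rewrite (msum_prod1 p V (fun j v => if j \in A then h v else 1) y us).
rewrite (perm_big _ pA) /= big_filter [RHS]big_mkcond /= big_seq [RHS]big_seq.
apply: eq_bigr => j js; case: ifP => // _.
by rewrite -[RHS](p1 j js); apply: eq_bigr => v _; rewrite mulr1.
Qed.

(* Weighted count of maps on a bipartite graph whose left vertices [i] have the four neighbours [r - i]: Finner's inequality reduces it to the complete bipartite graph K_{4,4}. *)
Lemma msum_bipartite (R : rcfType) (c : nat -> R) (V L S rs : seq nat) (l N : nat) (eta : R) y :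
  (forall v, 0 <= c v) -> 0 < \sum_(v <- V) c v ->
  uniq L -> uniq S -> {in L, forall i, i \notin S} ->
  uniq rs -> size rs = 4%N ->
  {in L & rs, forall i r, (i <= r)%N && (r - i \in S)%N} ->
  {in V, forall v, l <= v + N}%N ->
  0 <= eta -> biclique_weight c V l N <= eta ^+ 4 ->
  msum (fun _ => c) V (S ++ L)
    (fun k => \prod_(i <- L) (all (fun r => l <= k i + k (r - i)) rs)%N%:R) y <=
  (\sum_(v <- V) c v) ^+ size S * (eta / \sum_(v <- V) c v) ^+ size L.
Proof.
set W := \sum_(v <- V) c v.
move=> c0 W0 uL uS LS urs srs LrS lN e0 He.
pose f i (k : nat -> nat) := \sum_(v <- V) c v * (all (fun r => l <= v + k (r - i)) rs)%N%:R.
have f0 i k : 0 <= f i k by apply: sumr_ge0 => v _; rewrite mulr_ge0.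
rewrite msum_cat.
have inner z : msum (fun _ => c) V L
    (fun k => \prod_(i <- L) (all (fun r => l <= k i + k (r - i)) rs)%N%:R) z =
    \prod_(i <- L) f i z.
  pose h i v (k : nat -> nat) : R :=
    if i \in L then (all (fun r => l <= v + k (r - i)) rs)%N%:R else 1.
  transitivity (msum (fun _ => c) V L (fun k => \prod_(i <- L) h i (k i) k) z).
    apply: eq_msum => k; rewrite big_seq [RHS]big_seq; apply: eq_bigr => i iL.
    by rewrite /h iL.
  rewrite (msum_prod (fun _ => c)) //.
    by rewrite big_seq [RHS]big_seq; apply: eq_bigr => i iL; apply: eq_bigr => v _; rewrite /h iL.
  move=> i v j jL k w; rewrite /h; case: ifP => // iL; congr (_%:R); congr nat_of_bool.
  apply: eq_in_all => r rr; rewrite upd_other //.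
  have /andP[_ rS] := LrS i r iL rr; by apply: contraTneq rS => ->; exact: LS.
rewrite (eq_msum _ _ _ _ inner).
(* Finner's inequality needs probability weights; normalising the right side [S] costs the factor
   [W ^+ size S]. *)
pose p (j v : nat) := c v / W.
have p0 j v : 0 <= p j v by rewrite divr_ge0 ?(ltW W0).
have p1 j : j \in S -> \sum_(v <- V) p j v = 1.
  by move=> _; rewrite -big_distrl /= divff // gt_eqF.
have -> : msum (fun _ => c) V S (fun z => \prod_(i <- L) f i z) y =
    W ^+ size S * msum p V S (fun z => \prod_(i <- L) f i z) y.
  rewrite -msum_scale; apply: eq_msum_weight => j v _ _.
  by rewrite /p mulrC divfK // gt_eqF.
rewrite ler_wpM2l ?exprn_ge0 ?(ltW W0) //.
pose dep i j := has (fun r => r - i == j)%N rs.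
pose F i k := if i \in L then f i k else 1.
have -> : msum p V S (fun z => \prod_(i <- L) f i z) y =
    msum p V S (fun z => \prod_(i <- L) F i z) y.
  apply: eq_msum => k; rewrite big_seq [RHS]big_seq; apply: eq_bigr => i iL.
  by rewrite /F iL.
apply: le_trans (@finner4 R nat p V S L F dep y p0 p1 _ _ _) _.
- by move=> i k; rewrite /F; case: ifP.
- move=> i j nd k w; rewrite /F; case: ifP => // iL.
  apply: eq_bigr => v _; congr (_ * _%:R); congr nat_of_bool.
  apply: eq_in_all => r rr; rewrite upd_other //.
  by apply: contraNneq nd => <-; apply/hasP; exists r.
(* A right vertex [j] can only be adjacent to the left vertices [r - j], one for each of the four
   [r]. *)
- move=> j jS; rewrite -size_filter -srs -(size_map (fun r => r - j)%N rs).
  apply: uniq_leq_size; first exact: filter_uniq.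
  move=> i; rewrite mem_filter => /andP[/hasP[r rr /eqP rij] iL].
  apply/mapP; exists r => //; have /andP[ir _] := LrS i r iL rr; by rewrite -rij subKn.
rewrite -(count_predT L) -[leRHS]iter_mulr_1 -big_const_seq big_seq [leRHS]big_seq.
apply: ler_prod => i iL; rewrite root4_ge0 /=.
apply: le_root4; first by rewrite divr_ge0 ?(ltW W0).
rewrite expr_div_n.
pose A := [seq (r - i)%N | r <- rs].
have uA : uniq A.
  rewrite map_inj_in_uniq // => r r' rr rr' e.
  have /andP[ir _] := LrS i r iL rr; have /andP[ir' _] := LrS i r' iL rr'.
  by rewrite -(subnK ir) e subnK.
have AS : {subset A <= S}.
  by move=> _ /mapP[r rr ->]; have /andP[_ ] := LrS i r iL rr.
pose g a := (\sum_(v <- V) c v * (l <= v + a)%N%:R) ^+ 4.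
(* The constraints on the value at [i] depend only on the minimum of the four neighbours, so the
   fourth power is [g] of that minimum. *)
have fE k : F i k ^+ 4 = \sum_(a < N.+1) increment g a * \prod_(j <- A) (a <= k j)%N%:R.
  (* Capping the minimum at [N] changes nothing: by [lN] a neighbour with value [N] already
     satisfies the constraint for every [v] in [V]. *)
  pose M := \big[minn/N]_(r <- rs) k (r - i)%N.
  have MN : (M <= N)%N.
    by have := leqnn M; rewrite {2}/M leq_bigmin => /andP[].
  transitivity (g M).
    rewrite /F iL /g /f; congr (_ ^+ 4); rewrite big_seq [RHS]big_seq.
    apply: eq_bigr => v vV; congr (_ * _%:R); congr nat_of_bool.
    rewrite -leq_subLR leq_bigmin leq_subLR lN //=; apply: eq_all => r.
    by rewrite leq_subLR.
  rewrite -(telescope_indicator g MN); apply: eq_bigr => a _; congr (_ * _).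
  rewrite prodr_bool leq_bigmin -ltnS ltn_ord /= /A all_map; congr (_%:R).
rewrite (eq_msum _ _ _ _ fE) msum_sum.
apply: (@le_trans _ _ (biclique_weight c V l N / W ^+ 4)); last first.
  by rewrite ler_wpM2r // invr_ge0 exprn_ge0 // ltW.
rewrite /biclique_weight mulr_suml; apply: ler_sum => a _.
rewrite msumZl (msum_prod_subset (fun v => (a <= v)%N%:R)) // -/(increment g a) -mulrA.
rewrite (eq_bigr (fun=> upper_weight c V a / W)); last first.
  by move=> j _; rewrite mulr_suml; apply: eq_bigr => v _; rewrite mulrAC.
by rewrite big_const_seq count_predT iter_mulr_1 size_map srs expr_div_n.
Qed.

(** * Powers of 1/phi and the numerical bound for K_{4,4} *)

Definition golden_conj (R : rcfType) : R := (Num.sqrt 5 - 1) / 2.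

Lemma golden_conj_gt0 (R : rcfType) : 0 < golden_conj R.
Proof.
rewrite /golden_conj divr_gt0 // subr_gt0 -[ltLHS]sqrtr1 ltr_sqrt //; lra.
Qed.

Lemma golden_conj_sqr (R : rcfType) : golden_conj R ^+ 2 = 1 - golden_conj R.
Proof.
have h : Num.sqrt (5 : R) ^+ 2 = 5 by rewrite sqr_sqrtr.
rewrite /golden_conj; move: h; move: (Num.sqrt 5) => s h; lra.
Qed.

(** Two consecutive ratios of Fibonacci numbers. Powers of z are linear in z, so the numerical
    estimates below can be settled by these bounds and linear arithmetic. *)
Lemma golden_conj_bounds (R : rcfType) : 21 / 34 < golden_conj R < 34 / 55.
Proof.
have := golden_conj_gt0 R; have := golden_conj_sqr R.
move: (golden_conj R) => z zz z0; apply/andP; split; nra.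
Qed.

Lemma golden_conj_powers (R : rcfType) (z := golden_conj R) :
  [/\ z ^+ 3 = 2 * z - 1, z ^+ 4 = 2 - 3 * z, z ^+ 5 = 5 * z - 3 & z ^+ 6 = 5 - 8 * z].
Proof.
have zz : z ^+ 2 = 1 - z := golden_conj_sqr R.
have z3 : z ^+ 3 = 2 * z - 1 by rewrite exprS zz mulrBr -expr2 zz; ring.
have z4 : z ^+ 4 = 2 - 3 * z by rewrite exprS z3 mulrBr mulrCA -expr2 zz; ring.
have z5 : z ^+ 5 = 5 * z - 3 by rewrite exprS z4 mulrBr mulrCA -expr2 zz; ring.
have z6 : z ^+ 6 = 5 - 8 * z by rewrite exprS z5 mulrBr mulrCA -expr2 zz; ring.
by split.
Qed.

(* Values above the level [l] are charged a factor [u]: they are allowed, but only few coordinates take them. *)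
Definition level_weight (R : rcfType) (l : nat) (u : R) (v : nat) : R :=
  golden_conj R ^+ v * (if (v <= l)%N then 1 else u).

Lemma abel_increment (R : numDomainType) (g h : nat -> R) (N : nat) : h N.+1 = 0 ->
  \sum_(a < N.+1) increment g a * h a = \sum_(a < N.+1) g a * (h a - h a.+1).
Proof.
move=> hN; suff H n : \sum_(a < n.+1) increment g a * h a =
   \sum_(a < n.+1) g a * (h a - h a.+1) + g n * h n.+1 by rewrite H hN mulr0 addr0.
elim: n => [|n IH]; first by rewrite !big_ord1 /increment /=; ring.
by rewrite big_ord_recr /= IH [in RHS]big_ord_recr /= /increment; ring.
Qed.

(** The weights enter once directly and once through differences, so bounds cannot simply be
    substituted. As [g] increases, the direct factor may be replaced by [t]; summation by parts then
    moves the differences onto the decreasing [t], and [g] may be replaced too. *)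
Lemma biclique_weight_le (R : numDomainType) (c : nat -> R) (V : seq nat) (l N : nat) (t : nat -> R) :
  (forall v, 0 <= c v) -> (forall a, t a.+1 <= t a) -> (forall a, 0 <= t a) -> t N.+1 = 0 ->
  (forall a, upper_weight c V a <= t a) ->
  biclique_weight c V l N <= \sum_(a < N.+1) t (l - a)%N ^+ 4 * (t a ^+ 4 - t a.+1 ^+ 4).
Proof.
move=> c0 tdec t0 tN Tt; rewrite /biclique_weight.
set g := fun a => (_ ^+ 4).
have U0 a : 0 <= upper_weight c V a by apply: sumr_ge0 => v _; rewrite mulr_ge0.
have gE a : g a = upper_weight c V (l - a) ^+ 4.
  rewrite /g /upper_weight; congr (_ ^+ 4); apply: eq_bigr => v _.
  by rewrite leq_subLR addnC.
have inc0 a : 0 <= increment g a.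
  rewrite /increment; case: a => [|a]; first by rewrite subr0 gE exprn_ge0.
  rewrite subr_ge0 !gE; apply: lerXn2r; rewrite ?nnegrE //.
  apply: ler_sum => v _; rewrite ler_wpM2l // ler_nat.
  by case: (leqP (l - a) v) => // h; rewrite (leq_trans _ h) ?leq_sub2l.
have t4 a : t a.+1 ^+ 4 <= t a ^+ 4 by apply: lerXn2r; rewrite ?nnegrE.
apply: (@le_trans _ _ (\sum_(a < N.+1) increment g a * t a ^+ 4)).
  by apply: ler_sum => a _; rewrite ler_wpM2l // lerXn2r ?nnegrE.
rewrite (@abel_increment _ g (fun a => t a ^+ 4)) ?tN ?expr0n //.
apply: ler_sum => a _; rewrite ler_wpM2r ?subr_ge0 // gE.
by rewrite lerXn2r ?nnegrE.
Qed.

Lemma level_weight_ge0 (R : rcfType) l (u : R) v : 0 <= u -> 0 <= level_weight l u v.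
Proof.
by move=> u0; rewrite mulr_ge0 ?exprn_ge0 ?(ltW (golden_conj_gt0 R)) //; case: ifP.
Qed.

(** Short rational upper bounds for [upper_weight (level_weight l u) (iota 1 6) a], listed by [a].
    Entries 0 and 1 agree since no value is 0; the entries 1/100 lie beyond the level, where only
    values charged with [u] remain. *)
Definition biclique_table (R : numFieldType) (l : nat) : seq R :=
  match l with
  | 3%N => [:: 5 / 4; 5 / 4; 5 / 8; 1 / 4; 1 / 100; 1 / 100; 1 / 100]
  | 4%N => [:: 7 / 5; 7 / 5; 7 / 9; 2 / 5; 3 / 20; 1 / 100; 1 / 100]
  | 5%N => [:: 3 / 2; 3 / 2; 7 / 8; 1 / 2; 1 / 4; 1 / 10; 1 / 100]
  | _ => [:: 8 / 5; 8 / 5; 1; 3 / 5; 3 / 10; 3 / 20; 3 / 50]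
  end.

Lemma upper_weight_gt (R : numDomainType) (c : nat -> R) n a :
  (n < a)%N -> upper_weight c (iota 1 n) a = 0.
Proof.
move=> na; rewrite /upper_weight big1_seq // => v /andP[_]; rewrite mem_iota add1n ltnS.
by move=> /andP[_ vn]; rewrite leqNgt (leq_ltn_trans vn na) mulr0.
Qed.

(** Level 3 is the tight case: the table gives about 0.72, against [(19 / 20) ^+ 4], about 0.81. *)
Lemma level_biclique_weight (R : rcfType) l (u : R) : (3 <= l <= 6)%N -> 0 <= u <= 1 / 100 ->
  biclique_weight (level_weight l u) (iota 1 6) l 6 <= (19 / 20) ^+ 4.
Proof.
move=> l36 /andP[u0 u1].
pose t a := nth 0 (biclique_table R l) a.
have lE : l = 3 \/ l = 4 \/ l = 5 \/ l = 6 by lia.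
apply: le_trans (@biclique_weight_le R _ _ _ _ t _ _ _ _ _) _.
- by move=> v; apply: level_weight_ge0.
- by move=> a; rewrite /t; case: lE => [->|[->|[->|->]]];
    do 7![case: a => [|a]; first by rewrite /=; lra]; rewrite /= ?nth_nil.
- by move=> a; rewrite /t; case: lE => [->|[->|[->|->]]];
    do 7![case: a => [|a]; first by rewrite /=; lra]; rewrite /= ?nth_nil.
- by rewrite /t; case: lE => [->|[->|[->|->]]].
- have [z3 z4 z5 z6] := golden_conj_powers R; have z2 := golden_conj_sqr R.
  have /andP[zl zh] := golden_conj_bounds R.
  have z0 : 0 <= golden_conj R by lra.
  have y1 : golden_conj R ^+ 1 <= 34 / 55 by rewrite expr1; lra.
  have y2 : golden_conj R ^+ 2 <= 13 / 34 by rewrite z2; lra.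
  have y3 : golden_conj R ^+ 3 <= 13 / 55 by rewrite z3; lra.
  have y4 : golden_conj R ^+ 4 <= 5 / 34 by rewrite z4; lra.
  have y5 : golden_conj R ^+ 5 <= 1 / 11 by rewrite z5; lra.
  have y6 : golden_conj R ^+ 6 <= 2 / 34 by rewrite z6; lra.
  have uz v b : golden_conj R ^+ v <= b -> 0 <= golden_conj R ^+ v * u <= b / 100.
    move=> zb; have zv : 0 <= golden_conj R ^+ v by rewrite exprn_ge0.
    by rewrite mulr_ge0 //=; apply: ler_pM => //; lra.
  move: y1 y2 y3 y4 y5 y6 (uz _ _ y4) (uz _ _ y5) (uz _ _ y6).
  rewrite /t => + + + + + + + + + a.
  have [a6|a6] := ltnP a 7; last first.
    move=> *; rewrite nth_default; last by case: lE => [->|[->|[->|->]]].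
    by rewrite upper_weight_gt.
  move=> + + + + + + + + +; clear -lE a6.
  rewrite /upper_weight !big_cons big_nil /level_weight; move: (golden_conj R) => z.
  case: lE => [->|[->|[->|->]]];
    do 7![case: a a6 => [|a] a6; first by rewrite /= ?mulr1 ?mulr0 ?add0r ?addr0;
      move: (z ^+ 4 * u) (z ^+ 5 * u) (z ^+ 6 * u);
      move: (z ^+ 1) (z ^+ 2) (z ^+ 3) (z ^+ 4) (z ^+ 5) (z ^+ 6) => *; lra];
    by exfalso; clear -a6; lia.
- rewrite !big_ord_recr big_ord0 /t.
  by case: lE => [->|[->|[->|->]]]; rewrite /=; lra.
Qed.

(** * Kunz coordinates *)

Local Close Scope ring_scope.

(** Cuts off windows of length [W] from the right until one contains four points of [T]. Each window
    passed holds at most three, which bounds the points beyond [x]; if all are passed, the whole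
    range has at most [3 * t]. *)
Lemma dense_window (T : pred nat) (W t n : nat) : n <= t * W ->
  count T (iota 0 n) <= 3 * t \/
  exists x, [/\ x <= n, count T (iota x (n - x)) <= 3 * t &
                4 <= count T (iota (x - W) (x - (x - W)))].
Proof.
elim: t n => [|t IH] n; first by rewrite leqn0 => /eqP ->; left.
move=> nW; have [w4|w3] := leqP 4 (count T (iota (n - W) (n - (n - W)))).
  by right; exists n; rewrite subnn leqnn.
have n'W : n - W <= t * W by lia.
case: (IH _ n'W) => [c0|[x [xn cx x4]]].
  left; rewrite -[X in iota 0 X](subnKC (leq_subr W n)) iotaD count_cat add0n; lia.
right; exists x; split => //; first by lia.
rewrite (_ : n - x = (n - W - x) + (n - (n - W))); last by lia.
rewrite iotaD count_cat (_ : x + (n - W - x) = n - W); last by lia.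
by lia.
Qed.

(** The bound of the total count by [x + 3 * t] is what later makes [x] a positive proportion of the
    multiplicity. *)
Lemma dense_cluster (T : pred nat) (W t n : nat) :
  n <= t * W -> 3 * t < count T (iota 0 n) ->
  exists x (rs : seq nat), [/\ x <= n, count T (iota 0 n) <= x + 3 * t,
    count T (iota x (n - x)) <= 3 * t, uniq rs /\ size rs = 4 &
    {in rs, forall r, [/\ T r, r < x & x <= r + W]}].
Proof.
move=> nW cT; case: (dense_window T nW) => [|[x [xn cx x4]]]; first by lia.
exists x, (take 4 [seq r <- iota (x - W) (x - (x - W)) | T r]); split => //.
- rewrite -[X in iota 0 X](subnKC xn) iotaD count_cat add0n leq_add //.
  by rewrite (leq_trans (count_size _ _)) // size_iota.
- by rewrite take_uniq ?filter_uniq ?iota_uniq // size_takel // size_filter.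
- move=> r /mem_take; rewrite mem_filter mem_iota => /andP[Tr h].
  by split => //; lia.
Qed.

Definition first_fail (P : pred nat) (N : nat) := find (predC P) (iota 0 N.+1).

Lemma first_failP (P : pred nat) N : ~~ P N ->
  [/\ first_fail P N <= N, ~~ P (first_fail P N) & forall t, t < first_fail P N -> P t].
Proof.
move=> PN; have hP : has (predC P) (iota 0 N.+1).
  by apply/hasP; exists N; rewrite // mem_iota add0n leqnn.
have lt : first_fail P N < N.+1 by rewrite -[X in _ < X](size_iota 0) -has_find.
split => //; first by have := nth_find 0 hP; rewrite nth_iota.
move=> t tl; have /negbFE := before_find 0 tl.
by rewrite nth_iota // (ltn_trans tl).
Qed.

Definition mult (g : nat) (H : {set 'I_(2 * g)}) : nat :=
  (first_fail (fun n => isgap H n.+1) (2 * g)).+1.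

(** The value 0 outside [0 < i < mult H] is convenient twice: at residue 0 it says that multiples of
    the multiplicity are not gaps, and elsewhere it agrees with the base vector [fun=> 0] of the
    weighted sums. *)
Definition kunz (g : nat) (H : {set 'I_(2 * g)}) (i : nat) : nat :=
  if 0 < i < mult H then first_fail (fun t => isgap H (i + t * mult H)) (2 * g) else 0.

Lemma isgap_lt (g : nat) (H : {set 'I_(2 * g)}) n : isgap H n -> n < 2 * g.
Proof. by case/existsP => z /andP[_ /eqP <-]. Qed.

Lemma isgap_ord (g : nat) (H : {set 'I_(2 * g)}) (x : 'I_(2 * g)) : isgap H x = (x \in H).
Proof.
apply/existsP/idP => [[z /andP[zH /eqP zx]]|xH]; last by exists x; rewrite xH /=.
by have <- : z = x by exact: ord_inj.
Qed.

Lemma gapset_add (g : nat) (H : {set 'I_(2 * g)}) a b : H \in NS g ->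
  ~~ isgap H a -> ~~ isgap H b -> ~~ isgap H (a + b).
Proof.
rewrite inE => /andP[_ /andP[_ /forallP cl]] Ha Hb.
have [a2|a2] := leqP (2 * g) a; first by apply/negP => /isgap_lt; lia.
have [b2|b2] := leqP (2 * g) b; first by apply/negP => /isgap_lt; lia.
by have /forallP/(_ (Ordinal b2))/implyP/(_ Ha)/implyP/(_ Hb) := cl (Ordinal a2).
Qed.

Lemma gapset_mul (g : nat) (H : {set 'I_(2 * g)}) a t : H \in NS g ->
  ~~ isgap H a -> ~~ isgap H (t * a).
Proof.
move=> HN Ha; elim: t => [|t IH]; last by rewrite mulSn gapset_add.
by move: HN; rewrite inE => /andP[_ /andP[]].
Qed.

Lemma mult_gt0 (g : nat) (H : {set 'I_(2 * g)}) : 0 < mult H.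
Proof. by []. Qed.

Lemma mult_nongap (g : nat) (H : {set 'I_(2 * g)}) : ~~ isgap H (mult H).
Proof.
have P : ~~ (fun n => isgap H n.+1) (2 * g) by apply/negP => /isgap_lt; lia.
by have [_ ? _] := @first_failP (fun n => isgap H n.+1) _ P.
Qed.

Lemma lt_mult_gap (g : nat) (H : {set 'I_(2 * g)}) i : 0 < i < mult H -> isgap H i.
Proof.
have P : ~~ (fun n => isgap H n.+1) (2 * g) by apply/negP => /isgap_lt; lia.
have [_ _ lt] := @first_failP (fun n => isgap H n.+1) _ P.
by case: i => // i /= im; apply: lt; rewrite -ltnS.
Qed.

Lemma kunz_out (g : nat) (H : {set 'I_(2 * g)}) i : ~~ (0 < i < mult H) -> kunz H i = 0.
Proof. by rewrite /kunz => /negbTE ->. Qed.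

Lemma isgap_kunz (g : nat) (H : {set 'I_(2 * g)}) i t : H \in NS g -> i < mult H ->
  isgap H (i + t * mult H) = (t < kunz H i).
Proof.
move=> HN im; rewrite /kunz im andbT.
have [-> | i0] := posnP i; first by rewrite add0n ltn0; apply/negbTE/gapset_mul/mult_nongap.
have P : ~~ (fun t => isgap H (i + t * mult H)) (2 * g).
  by apply/negP => /isgap_lt; have := mult_gt0 H; nia.
have [_ nf lt] := @first_failP (fun t => isgap H (i + t * mult H)) _ P.
set f := first_fail _ _ in nf lt *.
have [tf|ft] := ltnP t f; first exact: lt.
rewrite -(subnKC ft) mulnDl addnA; apply/negbTE/gapset_add => //.
exact/gapset_mul/mult_nongap.
Qed.

Lemma isgap_divn (g : nat) (H : {set 'I_(2 * g)}) n : H \in NS g ->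
  isgap H n = (n %/ mult H < kunz H (n %% mult H)).
Proof.
by move=> HN; rewrite -isgap_kunz ?ltn_mod // addnC -divn_eq.
Qed.

Lemma kunz_gt0 (g : nat) (H : {set 'I_(2 * g)}) i : H \in NS g ->
  0 < i < mult H -> 0 < kunz H i.
Proof.
move=> HN im; rewrite -isgap_kunz //; last by case/andP: im.
by rewrite mul0n addn0 lt_mult_gap.
Qed.

(** The least elements [i + k_i m] and [j + k_j m] of two residue classes add up to an element of
    the class of [i + j]. *)
Lemma kunz_add (g : nat) (H : {set 'I_(2 * g)}) i j : H \in NS g ->
  i + j < mult H -> kunz H (i + j) <= kunz H i + kunz H j.
Proof.
move=> HN ijm; rewrite leqNgt -isgap_kunz // mulnDl addnACA.
by apply: gapset_add => //; rewrite isgap_kunz ?ltnn //; lia.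
Qed.

(** The same sum as in [kunz_add], but the residues now carry one further [m]; this is the unit lost
    by wrapping. *)
Lemma kunz_add_wrap (g : nat) (H : {set 'I_(2 * g)}) i j : H \in NS g ->
  i < mult H -> j < mult H -> mult H <= i + j ->
  kunz H (i + j - mult H) <= (kunz H i + kunz H j).+1.
Proof.
move=> HN im jm ijm; rewrite leqNgt -isgap_kunz //; last by lia.
rewrite mulSn addnA subnK // mulnDl addnACA.
by apply: gapset_add => //; rewrite isgap_kunz ?ltnn.
Qed.

(** All gaps lie below [2 * g], so the range may be extended to [2 * g * m] and read as a rectangle
    with rows [t] and columns [i]. Stated for an arbitrary description [k] of the gaps because it
    serves both the Kunz coordinates and the semigroups built from compositions. *)
Lemma sum_over_gaps (g m : nat) (H : {set 'I_(2 * g)}) (k F : nat -> nat) :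
  0 < m -> (forall n, isgap H n = (n %/ m < k (n %% m))) -> k 0 = 0 ->
  \sum_(x in H) F x = \sum_(1 <= i < m) \sum_(t < k i) F (i + t * m).
Proof.
move=> m0 Hk k0.
have gk i t : i < m -> isgap H (i + t * m) = (t < k i).
  by move=> im; rewrite Hk addnC divnMDl // modnMDl divn_small // modn_small // addn0.
have kb i : i < m -> k i <= 2 * g.
  move=> im; rewrite leqNgt; apply/negP; rewrite -gk // => /isgap_lt; nia.
transitivity (\sum_(n < 2 * g) if isgap H n then F n else 0).
  by rewrite big_mkcond; apply: eq_bigr => x _; rewrite isgap_ord.
transitivity (\sum_(n < 2 * g * m) if isgap H n then F n else 0).
  rewrite -!(big_mkord xpredT (fun n => if isgap H n then F n else 0)).
  rewrite [RHS](big_cat_nat (n := 2 * g)) ?leq_pmulr //=.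
  rewrite [X in _ + X]big_nat_cond [X in _ + X]big1 ?addn0 // => n /andP[/andP[gn _] _].
  by case: ifP => // /isgap_lt; rewrite ltnNge gn.
transitivity (\sum_(t < 2 * g) \sum_(i < m) if t < k i then F (i + t * m) else 0).
  elim: (2 * g) => [|M IH]; first by rewrite !big_ord0.
  rewrite big_ord_recr /= -IH mulSn addnC big_split_ord /=; congr (_ + _).
  by apply: eq_bigr => i _; rewrite addnC gk.
rewrite exchange_big /= -(big_mkord xpredT (fun i => \sum_(t < 2 * g) if t < k i then F (i + t * m) else 0)).
rewrite big_ltn // [X in X + _]big1 ?add0n; last by move=> t _; rewrite k0.
rewrite big_nat_cond [RHS]big_nat_cond; apply: eq_bigr => i /andP[/andP[_ im] _].
by rewrite (big_ord_widen _ (fun t => F (i + t * m)) (kb i im)) [RHS]big_mkcond.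
Qed.

Lemma kunz0 (g : nat) (H : {set 'I_(2 * g)}) : kunz H 0 = 0.
Proof. by []. Qed.

Lemma sum_kunz (g : nat) (H : {set 'I_(2 * g)}) : H \in NS g ->
  \sum_(1 <= i < mult H) kunz H i = g.
Proof.
move=> HN; have := sum_over_gaps (fun=> 1) (mult_gt0 H) (fun n => isgap_divn n HN) (kunz0 H).
have cH : #|H| = g by move: HN; rewrite inE => /andP[/eqP].
rewrite sum1_card => E; apply: etrans cH; rewrite E.
by apply: eq_bigr => i _; rewrite sum1_card card_ord.
Qed.

Lemma mult_le (g : nat) (H : {set 'I_(2 * g)}) : H \in NS g -> mult H <= g.+1.
Proof.
move=> HN; have := leqnn g; rewrite -{1}(sum_kunz HN) => h.
rewrite -[g.+1]add1n -leq_subLR; apply: leq_trans h.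
apply: (@leq_trans (\sum_(1 <= i < mult H) 1)); first by rewrite sum_nat_const_nat muln1.
by rewrite big_nat_cond [X in _ <= X]big_nat_cond leq_sum // => i /andP[im _]; exact: kunz_gt0.
Qed.

Lemma kunz_le (g : nat) (H : {set 'I_(2 * g)}) i : H \in NS g -> kunz H i <= g.
Proof.
move=> HN; have [im|/kunz_out -> //] := boolP (0 < i < mult H).
apply: leq_trans (eq_leq (sum_kunz HN)); rewrite (big_rem i) /= ?leq_addr //.
by rewrite mem_index_iota.
Qed.

Lemma kunz_inj (g : nat) (H H' : {set 'I_(2 * g)}) : H \in NS g -> H' \in NS g ->
  mult H = mult H' -> (forall i, 0 < i < mult H -> kunz H i = kunz H' i) -> H = H'.
Proof.
move=> HN HN' mE kE; apply/setP => x; rewrite -!isgap_ord !isgap_divn // mE.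
congr (_ < _); have [|h] := boolP (0 < x %% mult H' < mult H'); last by rewrite !kunz_out // mE.
by rewrite -mE => /kE.
Qed.

(** * A lower bound on the number of semigroups *)

(** Compositions of [n] and of [n + 1] into parts 1 and 2, carried together so that the Fibonacci
    recursion is structural. *)
Fixpoint comps_pair (n : nat) : seq (seq nat) * seq (seq nat) :=
  if n is n'.+1 then
    let: (a, b) := comps_pair n' in (b, map (cons 1) b ++ map (cons 2) a)
  else ([:: [::]], [:: [:: 1]]).

Definition comps (n : nat) : seq (seq nat) := (comps_pair n).1.

Lemma comps_rec n : comps n.+2 = map (cons 1) (comps n.+1) ++ map (cons 2) (comps n).
Proof. by rewrite /comps /=; case: (comps_pair n). Qed.

Lemma comps_ind (P : nat -> Prop) : P 0 -> P 1 -> (forall n, P n -> P n.+1 -> P n.+2) ->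
  forall n, P n.
Proof.
move=> P0 P1 PS n; suff: P n /\ P n.+1 by case.
by elim: n => [//|n [Pn PSn]]; split => //; apply: PS.
Qed.

Lemma comps_uniq n : uniq (comps n).
Proof.
elim/comps_ind: n => [//|//|n un uSn]; rewrite comps_rec cat_uniq.
rewrite !map_inj_uniq ?un ?uSn ?andbT; try by move=> s t [].
by apply/hasPn => _ /mapP[s _ ->]; apply/negP => /mapP[t _].
Qed.

Lemma compsP n s : s \in comps n -> all (fun x => 0 < x <= 2) s && (sumn s == n).
Proof.
elim/comps_ind: n s => [s|s|n IH IHS s].
- by rewrite inE => /eqP ->.
- by rewrite inE => /eqP ->.
rewrite comps_rec mem_cat => /orP[] /mapP[t tc ->] /=.
  by have /andP[-> /eqP ->] := IHS _ tc; rewrite eqxx.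
by have /andP[-> /eqP ->] := IH _ tc; rewrite eqxx.
Qed.

(** The right side at [n + 2] is z times its value at [n + 1] plus z^2 times its value at [n]. Since
    z + z^2 = 1, this is a weighted mean, and the lower bound z at 0 and 1 persists. *)
Lemma size_comps_ge (R : rcfType) n :
  (golden_conj R <= golden_conj R ^+ n * (size (comps n))%:R)%R.
Proof.
have z0 := golden_conj_gt0 R; have zz := golden_conj_sqr R.
elim/comps_ind: n => [||n IH IHS].
- by rewrite expr0 mul1r /=; nra.
- by rewrite expr1 mulr1.
rewrite comps_rec size_cat !size_map natrD mulrDr.
set A := ((size (comps n.+1))%:R)%R in IHS *; set B := ((size (comps n))%:R)%R in IH *.
have -> : (golden_conj R ^+ n.+2 * A + golden_conj R ^+ n.+2 * B =
  golden_conj R * (golden_conj R ^+ n.+1 * A) + golden_conj R ^+ 2 * (golden_conj R ^+ n * B))%R.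
  by rewrite !exprS; ring.
apply: (@le_trans _ _ (golden_conj R * golden_conj R + golden_conj R ^+ 2 * golden_conj R)%R).
  rewrite -expr2 zz; move: (golden_conj R) zz z0 => z zz z0.
  by rewrite le_eqVlt; apply/orP; left; apply/eqP; rewrite mulrBl mul1r -expr2 zz; ring.
by apply: lerD; apply: ler_wpM2l => //; rewrite ?exprn_ge0 // ltW.
Qed.

(* The Kunz coordinates of the semigroup are the entries of [s]; the index shift is absorbed by the leading [0]. *)
Definition comp_gap (s : seq nat) (n : nat) : bool :=
  n %/ (size s).+1 < nth 0 (0 :: s) (n %% (size s).+1).

Definition comp_gapset (g : nat) (s : seq nat) : {set 'I_(2 * g)} :=
  [set x : 'I_(2 * g) | comp_gap s x].

Lemma size_le_sumn s : all (fun x => 0 < x <= 2) s -> size s <= sumn s.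
Proof. by elim: s => //= x s IH /andP[/andP[x0 _] /IH]; lia. Qed.

Lemma size_lt_sumn s i : all (fun x => 0 < x <= 2) s -> 1 < nth 0 s i -> size s < sumn s.
Proof.
elim: s i => [|x s IH] i //=; first by rewrite nth_nil.
case/andP => /andP[x0 _] al; case: i => [|i] /= h; have := size_le_sumn al; first by lia.
by have := IH i al h; lia.
Qed.

Lemma comp_nth_bound s i : all (fun x => 0 < x <= 2) s -> nth 0 (0 :: s) i <= 2.
Proof.
move=> al; case: i => [//|i] /=; have [h|h] := ltnP i (size s).
  by have /andP[] := all_nthP 0 al i h.
by rewrite nth_default.
Qed.

(** A gap beyond the multiplicity comes from a part equal to 2, and such a part makes the sum exceed
    the length. *)
Lemma comp_gap_lt s n : all (fun x => 0 < x <= 2) s -> comp_gap s n -> n < 2 * sumn s.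
Proof.
move=> al; rewrite /comp_gap; set m := (size s).+1 => h.
have rm : n %% m < m by rewrite ltn_mod.
have b := comp_nth_bound (n %% m) al.
have nE := divn_eq n m; have sl := size_le_sumn al.
case: (n %% m) h rm b nE => [//|i] /= h rm b nE.
case: (posnP (n %/ m)) => [q0|q0]; first by rewrite q0 in nE; lia.
have q1 : n %/ m = 1 by lia.
rewrite q1 in h nE; have := size_lt_sumn al h; lia.
Qed.

Lemma comp_small_gap s i : all (fun x => 0 < x <= 2) s -> 0 < i < (size s).+1 -> comp_gap s i.
Proof.
move=> al /andP[i0 im]; rewrite /comp_gap divn_small // modn_small //.
by case: i i0 im => // i _ im /=; have /andP[] := all_nthP 0 al i im.
Qed.

Lemma comp_gap_size s : ~~ comp_gap s (size s).+1.
Proof. by rewrite /comp_gap modnn ltn0. Qed.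

Lemma isgap_comp g s n : s \in comps g -> isgap (comp_gapset g s) n = comp_gap s n.
Proof.
move=> /compsP/andP[al /eqP sg]; apply/idP/idP => [/existsP[z /andP[]]|ng].
  by rewrite inE => h /eqP <-.
have n2 : n < 2 * g by rewrite -sg comp_gap_lt.
by apply/existsP; exists (Ordinal n2); rewrite inE /= ng /=.
Qed.

(** Two nonzero non-gaps are at least the multiplicity [(size s).+1], so their sum is at least twice
    it; with parts at most 2 there are no gaps that far out. *)
Lemma comp_gapset_NS g s : s \in comps g -> comp_gapset g s \in NS g.
Proof.
move=> sc; have /andP[al /eqP sg] := compsP sc; rewrite inE; apply/andP; split.
  have := sum_over_gaps (fun=> 1) (ltn0Sn (size s)) (fun n => isgap_comp n sc) (erefl 0).
  rewrite sum1_card => ->; rewrite -[X in _ == X]sg sumnE [X in _ == X](big_nth 0) big_add1 /=.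
  by apply/eqP; apply: eq_bigr => i _; rewrite sum1_card card_ord.
rewrite /is_semigroup_gapset isgap_comp // {1}/comp_gap mod0n /=.
apply/forallP => x; apply/forallP => y; rewrite !isgap_comp //.
apply/implyP => nx; apply/implyP => ny.
have [-> | x0] := posnP x; first by [].
have [-> | y0] := posnP y; first by rewrite addn0.
have lm w : 0 < w -> ~~ comp_gap s w -> (size s).+1 <= w.
  by move=> w0; apply: contraNT; rewrite -ltnNge => wm; rewrite comp_small_gap // w0.
have xm := lm _ x0 nx; have ym := lm _ y0 ny.
rewrite /comp_gap -leqNgt (leq_trans (comp_nth_bound _ al)) //.
by rewrite leq_divRL // mul2n -addnn leq_add.
Qed.

Lemma comp_gapset_inj g : {in comps g &, injective (comp_gapset g)}.
Proof.
move=> s s' sc sc' E; have /andP[al _] := compsP sc; have /andP[al' _] := compsP sc'.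
have gE n : comp_gap s n = comp_gap s' n by rewrite -!(isgap_comp _ (g := g)) // E.
have szE : size s = size s'.
  apply/eqP; rewrite eqn_leq; apply/andP; split; rewrite leqNgt; apply/negP => h.
    have := comp_gap_size s'; rewrite -gE comp_small_gap //=; lia.
  have := comp_gap_size s; rewrite gE comp_small_gap //=; lia.
apply: (@eq_from_nth _ 0) => // i im.
have /andP[a1 a2] := all_nthP 0 al i im.
rewrite szE in im; have /andP[b1 b2] := all_nthP 0 al' i im.
(* Parts are 1 or 2, and whether the multiplicity plus [i.+1] is a gap tells which. *)
have := gE (1 * (size s).+1 + i.+1).
rewrite /comp_gap -szE !divnMDl // !modnMDl divn_small ?modn_small ?ltnS ?szE //= addn0.
by move: a1 a2 b1 b2; do 3?[case: (nth 0 s i) => [|?]]; lia.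
Qed.

Lemma card_NS_ge g : size (comps g) <= #|NS g|.
Proof.
rewrite -(size_map (comp_gapset g)) cardE uniq_leq_size //.
  by rewrite map_inj_in_uniq ?comps_uniq //; exact: comp_gapset_inj.
by move=> _ /mapP[s sc ->]; rewrite mem_enum comp_gapset_NS.
Qed.

(** * Negligible families *)

Local Open Scope ring_scope.

Lemma polynomial_le_expR (R : realType) (d : nat) (c : R) : 0 < c ->
  exists2 C : R, 0 <= C & forall n : nat, (n.+1)%:R ^+ d <= C * expR (c * n%:R).
Proof.
elim: d c => [|d IH] c c0.
  exists 1 => // n; rewrite mul1r expr0 -[leLHS]expR0 ler_expR mulr_ge0 // ltW //.
have c20 : 0 < c / 2 by rewrite divr_gt0.
have [C C0 HC] := IH _ c20; exists (C * (1 + (c / 2)^-1)).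
  by rewrite mulr_ge0 // addr_ge0 // invr_ge0 ltW.
move=> n; rewrite exprSr.
have -> : c * n%:R = c / 2 * n%:R + c / 2 * n%:R by rewrite -mulrDl -splitr.
rewrite expRD mulrACA; apply: ler_pM; rewrite ?exprn_ge0 //.
apply: (@le_trans _ _ ((1 + (c / 2)^-1) * (1 + c / 2 * n%:R))); last first.
  by rewrite ler_wpM2l ?expR_ge1Dx // addr_ge0 // invr_ge0 ltW.
rewrite mulrDl mul1r mulrDr mulr1 mulKf ?gt_eqF // -[n.+1]addn1 natrD.
have := ler0n R n; have : 0 <= (c / 2)^-1 by rewrite invr_ge0 ltW.
have : 0 <= c / 2 * n%:R by rewrite mulr_ge0 // ltW.
by move: (c / 2)^-1 (c / 2 * n%:R) => a b; lra.
Qed.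

Definition gapset_pred := forall g : nat, pred {set 'I_(2 * g)}.

Definition negligible (R : realType) (P : gapset_pred) : Prop :=
  exists C c : R, [/\ 0 <= C, 0 < c & forall g,
    golden_conj R ^+ g * #|[set H in NS g | P g H]|%:R <= C * expR (- (c * g%:R))].

Lemma in_NS g (Q : pred {set 'I_(2 * g)}) H :
  (H \in [set H in NS g | Q H]) = (H \in NS g) && Q H.
Proof. by rewrite in_set. Qed.

Lemma golden_conj_ge0 (R : rcfType) : 0 <= golden_conj R.
Proof. exact/ltW/golden_conj_gt0. Qed.

Lemma negligible_sub (R : realType) (P Q : gapset_pred) :
  (forall g H, H \in NS g -> P g H -> Q g H) -> negligible R Q -> negligible R P.
Proof.
move=> PQ [C [c [C0 c0 H]]]; exists C, c; split => // g; apply: le_trans (H g).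
rewrite ler_wpM2l ?exprn_ge0 ?golden_conj_ge0 // ler_nat subset_leq_card //.
by apply/subsetP => x; rewrite !in_NS => /andP[xN /(PQ _ _ xN) ->]; rewrite xN.
Qed.

Lemma negligible_or (R : realType) (P Q : gapset_pred) :
  negligible R P -> negligible R Q -> negligible R (fun g H => P g H || Q g H).
Proof.
move=> [C [c [C0 c0 HP]]] [D [d [D0 d0 HQ]]].
exists (C + D), (Num.min c d); split; rewrite ?addr_ge0 ?lt_min ?c0 //.
move=> g.
have -> : [set H in NS g | P g H || Q g H] =
    [set H in NS g | P g H] :|: [set H in NS g | Q g H].
  by apply/setP => x; rewrite in_setU !in_NS andb_orr.
apply: (@le_trans _ _ (golden_conj R ^+ g * (#|[set H in NS g | P g H]|%:R + #|[set H in NS g | Q g H]|%:R))).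
  rewrite ler_wpM2l ?exprn_ge0 ?golden_conj_ge0 // -natrD ler_nat.
  by rewrite cardsU leq_subr.
rewrite mulrDr mulrDl lerD //.
  apply: le_trans (HP g) _; rewrite ler_wpM2l // ler_expR lerN2 ler_wpM2r //.
  by rewrite ge_min lexx.
apply: le_trans (HQ g) _; rewrite ler_wpM2l // ler_expR lerN2 ler_wpM2r //.
by rewrite ge_min lexx orbT.
Qed.

(** There are at most [g + 2] multiplicities to sum over; that factor and the polynomial one are
    absorbed by halving the rate [c]. *)
Lemma negligible_fiber (R : realType) (P : gapset_pred) (C c : R) (d : nat) :
  0 <= C -> 0 < c ->
  (forall g m, (m <= g.+1)%N ->
     golden_conj R ^+ g * #|[set H in NS g | (mult H == m) && P g H]|%:R <=
     C * (g.+2)%:R ^+ d * expR (- (c * g%:R))) ->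
  negligible R P.
Proof.
move=> C0 c0 HP; have c20 : 0 < c / 2 by rewrite divr_gt0.
have [D D0 HD] := polynomial_le_expR d.+1 c20.
exists (C * (D * expR (c / 2))), (c / 2); split => //; first by rewrite !mulr_ge0 ?expR_ge0.
move=> g; set B := C * (g.+2)%:R ^+ d * expR (- (c * g%:R)).
have B0 : 0 <= B by rewrite !mulr_ge0 ?exprn_ge0 ?expR_ge0.
apply: (@le_trans _ _ (\sum_(m < g.+2) B)); last first.
  rewrite sumr_const card_ord -[leLHS]mulr_natl /B.
  have -> : (g.+2)%:R * (C * (g.+2)%:R ^+ d * expR (- (c * g%:R))) =
     C * ((g.+2)%:R ^+ d.+1 * expR (- (c * g%:R))) by rewrite exprS; ring.
  rewrite -[leRHS]mulrA ler_wpM2l //.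
  apply: (@le_trans _ _ (D * expR (c / 2 * g.+1%:R) * expR (- (c * g%:R)))).
    by rewrite ler_wpM2r ?expR_ge0 // HD.
  rewrite -!mulrA ler_wpM2l // -!expRD ler_expR -[g.+1]addn1 natrD.
  by move: (g%:R : R) => x; lra.
apply: (@le_trans _ _ (\sum_(m < g.+2)
   golden_conj R ^+ g * #|[set H in NS g | (mult H == m) && P g H]|%:R)).
  rewrite -big_distrr /= ler_wpM2l ?exprn_ge0 ?golden_conj_ge0 // -natr_sum ler_nat.
  set A := [set H in NS g | _]; rewrite -sum1_card.
  rewrite (partition_big (fun H => inord (mult H) : 'I_g.+2) predT) //=.
  apply: leq_sum => m _; rewrite -sum1_card; rewrite eq_leq //; apply: eq_bigl => H.
  rewrite /A !in_NS -andbA; case: (boolP (H \in NS g)) => //= HN; rewrite andbC; congr (_ && _).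
  by rewrite -val_eqE /= inordK //; exact: mult_le.
by apply: ler_sum => m _; apply: HP; rewrite -ltnS.
Qed.

(** Decay in the multiplicity is as good as decay in the genus once [g < 10 * m], at a tenth of the
    rate. *)
Lemma negligible_by_mult (R : realType) (P : gapset_pred) (C c : R) (d : nat) :
  0 <= C -> 0 < c ->
  (forall g m, (0 < m)%N -> golden_conj R ^+ g * #|[set H in NS g | (mult H == m) && P g H]|%:R <=
     C * (m.+1)%:R ^+ d * expR (- (c * m%:R))) ->
  negligible R (fun g H => (g < 10 * mult H)%N && P g H).
Proof.
move=> C0 c0 HP; have c10 : 0 < c / 10 by rewrite divr_gt0.
apply: (negligible_fiber (d := d) C0 c10) => g m mg.
have [gm|gm] := ltnP g (10 * m); last first.
  rewrite (_ : [set H in NS g | _] = set0) ?cards0 ?mulr0 ?mulr_ge0 ?exprn_ge0 ?expR_ge0 //.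
  apply/setP => H; rewrite in_NS in_set0; case: eqP => [->|_] //=; rewrite ?andbF //.
  by rewrite ltnNge gm /= andbF.
have m0 : (0 < m)%N by case: (m) gm.
apply: (@le_trans _ _ (C * (m.+1)%:R ^+ d * expR (- (c * m%:R)))).
  apply: le_trans (HP g m m0); rewrite ler_wpM2l ?exprn_ge0 ?golden_conj_ge0 // ler_nat.
  rewrite subset_leq_card //; apply/subsetP => H; rewrite !in_NS.
  by move=> /and4P[-> -> _ ->].
apply: ler_pM; rewrite ?mulr_ge0 ?exprn_ge0 ?expR_ge0 //.
  by rewrite ler_wpM2l // lerXn2r ?nnegrE ?ler_nat.
rewrite ler_expR lerN2 -mulrA ler_wpM2l ?(ltW c0) //.
have : (g%:R : R) <= 10 * m%:R by rewrite -natrM ler_nat ltnW.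
by lra.
Qed.

(** * From counting semigroups to weighted sums; geometric tails *)

Lemma prod_kunz (R : comNzRingType) (x : R) (g m : nat) (H : {set 'I_(2 * g)}) (s : seq nat) :
  H \in NS g -> mult H = m -> perm_eq s (iota 1 m.-1) ->
  \prod_(j <- s) x ^+ kunz H j = x ^+ g.
Proof.
move=> HN Hm ps; rewrite prodrXr; congr (_ ^+ _); apply: etrans (sum_kunz HN).
by rewrite (perm_big _ ps) /index_iota subn1 Hm.
Qed.

(* Exponential Markov inequality with test functions [e] and [F]. *)
Lemma count_le_msum (R : realType) (P : gapset_pred) g m (V s : seq nat)
    (e : nat -> nat -> R) (F : (nat -> nat) -> R) :
  perm_eq s (iota 1 m.-1) -> (forall j v, 0 <= e j v) -> (forall y, 0 <= F y) ->
  (forall H, H \in NS g -> mult H = m -> P g H ->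
     (forall i, (0 < i < m)%N -> kunz H i \in V) /\
     1 <= (\prod_(j <- s) e j (kunz H j)) * F (kunz H)) ->
  golden_conj R ^+ g * #|[set H in NS g | (mult H == m) && P g H]|%:R <=
  msum (fun j v => golden_conj R ^+ v * e j v) V s F (fun=> 0%N).
Proof.
move=> ps e0 F0 HP; have ms := perm_mem ps.
set X := [set H in NS g | _].
have XP H : H \in X -> [/\ H \in NS g, mult H = m & P g H].
  by rewrite in_NS => /and3P[? /eqP ? ?].
have sE j : (j \in s) = (0 < j < m)%N.
  by rewrite ms mem_iota; case: (m) => [|k]; rewrite /= ?add1n //; lia.
apply: le_trans (@weighted_sum_le_msum R _ V s (enum X) (fun H => kunz H)
   (fun j v => golden_conj R ^+ v * e j v) F (fun=> 0%N) _ _ _ _ _ _ _); first last.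
- move=> H H'; rewrite !mem_enum => /XP[HN Hm _] /XP[HN' Hm' _] kE.
  apply: kunz_inj => //; first by rewrite Hm.
  by move=> i im; apply: kE; rewrite sE -Hm.
- by move=> H; rewrite mem_enum => /XP[HN Hm _] j; rewrite sE -Hm => /kunz_out.
- move=> H j; rewrite mem_enum sE => /XP[HN Hm PH]; by have [kV _] := HP H HN Hm PH; apply: kV.
- by move=> j v; rewrite mulr_ge0 ?exprn_ge0 ?golden_conj_ge0.
- by [].
- by rewrite (perm_uniq ps) iota_uniq.
- exact: enum_uniq.
rewrite big_enum /= mulr_natr -sumr_const; apply: ler_sum => H /XP[HN Hm PH].
(* The factor z^g, common to all [H], splits into the coordinate weights because the coordinates add
   up to [g]. *)
rewrite big_split /= (prod_kunz _ HN Hm ps) -mulrA -[leLHS]mulr1.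
rewrite ler_wpM2l ?exprn_ge0 ?golden_conj_ge0 //.
by have [] := HP H HN Hm PH.
Qed.

Lemma geometric_tail (R : numFieldType) (t : R) (n a : nat) : 0 <= t ->
  (\sum_(v <- iota 1 n) t ^+ v * (a < v)%N%:R) * (1 - t) <= t ^+ a.+1.
Proof.
move=> t0.
suff H : (\sum_(v <- iota 1 n) t ^+ v * (a < v)%N%:R) * (1 - t) = t ^+ a.+1 - t ^+ (maxn a n).+1.
  by rewrite H lerBlDr lerDl exprn_ge0.
elim: n => [|n IH]; first by rewrite big_nil mul0r maxn0 subrr.
have -> : iota 1 n.+1 = iota 1 n ++ [:: n.+1] by rewrite -(addn1 n) iotaD add1n addn1.
rewrite big_cat /= big_cons big_nil addr0 mulrDl IH.
have [an|an] := leqP a n; last by rewrite ltnNge an mulr0 mul0r addr0 (maxn_idPl an).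
rewrite ltnS an mulr1 (maxn_idPr (leqW an)) ![_ ^+ _.+1]exprS; ring.
Qed.

Lemma golden_tail (R : rcfType) (z := golden_conj R) (n a : nat) :
  \sum_(v <- iota 1 n) z ^+ v * (a < v)%N%:R <= z ^+ a.+1 / z ^+ 2.
Proof.
rewrite ler_pdivlMr ?exprn_gt0 ?golden_conj_gt0 // {2}/z golden_conj_sqr.
exact: geometric_tail (golden_conj_ge0 R).
Qed.

Lemma golden_total (R : rcfType) (n : nat) :
  \sum_(v <- iota 1 n) golden_conj R ^+ v <= (golden_conj R)^-1.
Proof.
have z0 := golden_conj_gt0 R.
have := golden_tail R n 0; rewrite expr1 expr2 invfM mulrA divff ?gt_eqF // mul1r.
apply: le_trans; rewrite big_seq [leRHS]big_seq; apply: ler_sum => v.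
by rewrite mem_iota => /andP[-> _]; rewrite mulr1.
Qed.

Lemma golden_inv_le2 (R : rcfType) : (golden_conj R)^-1 <= 2.
Proof.
have z0 := golden_conj_gt0 R; have /andP[zl _] := golden_conj_bounds R.
by rewrite -[leRHS]invrK lef_pV2 ?posrE ?invr_gt0 //; lra.
Qed.

(** Each [a <= 5] contributes at most z^4 by the tail over [b]; for [a > 5] the other value is free,
    which adds at most z^3. The total 5 z^4 + z^3 = 9 - 13 z is below 33/34 as z > 21/34. With 5 in
    place of 6 the same computation gives 4 z^3 + z^2, which exceeds 1. *)
Lemma golden_pair (R : rcfType) (z := golden_conj R) (n : nat) :
  \sum_(a <- iota 1 n) \sum_(b <- iota 1 n) z ^+ a * (z ^+ b * (6 <= a + b)%N%:R) <= 33 / 34.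
Proof.
have z0 : 0 < z := golden_conj_gt0 R.
have [z3 z4 _ _] := golden_conj_powers R; have /andP[zl zh] := golden_conj_bounds R.
apply: (@le_trans _ _ (\sum_(a <- iota 1 n) (z ^+ 4 * (a <= 5)%N%:R + z^-1 * (z ^+ a * (5 < a)%N%:R)))).
  rewrite big_seq [leRHS]big_seq; apply: ler_sum => a; rewrite mem_iota => /andP[a0 _].
  rewrite -big_distrr /=; have [a5|a5] := leqP a 5.
    rewrite mulr0 mulr0 addr0 mulr1.
    have -> : z ^+ 4 = z ^+ a * (z ^+ (5 - a).+1 / z ^+ 2).
      by rewrite mulrA -exprD addnS subnKC // -[6%N]/(4 + 2)%N exprD mulfK ?expf_neq0 ?gt_eqF.
    rewrite ler_wpM2l ?exprn_ge0 ?(ltW z0) //; apply: le_trans (golden_tail R n (5 - a)).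
    by rewrite le_eqVlt; apply/orP; left; apply/eqP; apply: eq_bigr => b _; rewrite ltn_subLR // addnC.
  rewrite mulr0 add0r mulr1 mulrC ler_wpM2r ?exprn_ge0 ?(ltW z0) //.
  apply: le_trans (golden_total R n); apply: ler_sum => b _.
  by rewrite ler_piMr ?exprn_ge0 ?(ltW z0) // lern1; case: (6 <= a + b)%N.
rewrite big_split /= -!big_distrr /=.
apply: (@le_trans _ _ (z ^+ 4 * 5 + z^-1 * (z ^+ 6 / z ^+ 2))).
  apply: lerD; last by rewrite ler_wpM2l ?invr_ge0 ?(ltW z0) // golden_tail.
  rewrite ler_wpM2l ?exprn_ge0 ?(ltW z0) // -natr_sum ler_nat.
  rewrite -big_mkcond /= sum1_count -size_filter.
  apply: (@uniq_leq_size _ _ (iota 1 5)); first by rewrite filter_uniq ?iota_uniq.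
  by move=> x; rewrite mem_filter !mem_iota => /andP[x5 /andP[x1 _]]; rewrite x1.
have -> : z^-1 * (z ^+ 6 / z ^+ 2) = z ^+ 3 by rewrite -[6%N]/(4 + 2)%N exprD mulfK ?expf_neq0 ?gt_eqF // exprS mulKf ?gt_eqF.
rewrite z3 z4 /z; lra.
Qed.

(** * Small multiplicity and large depth *)

Lemma power_le_expR (R : realType) (a : R) : 0 < a -> a < 1 ->
  exists2 c : R, 0 < c & forall n, a ^+ n = expR (- (c * n%:R)).
Proof.
move=> a0 a1; exists (- ln a); first by rewrite oppr_gt0 ln_lt0 // a0.
by move=> n; rewrite mulNr opprK mulrC expRM_natl lnK // posrE.
Qed.

Lemma negligible_small_mult (R : realType) : negligible R (fun g H => (10 * mult H <= g)%N).
Proof.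
have z0 := golden_conj_gt0 R; have /andP[zl zh] := golden_conj_bounds R.
pose t : R := 7 / 10; pose a : R := golden_conj R / t / (11 / 12).
have t0 : 0 < t by rewrite /t; lra.
have u0 : 0 < 11 / 12 :> R by lra.
have a0 : 0 < a by rewrite /a; apply: divr_gt0 => //; apply: divr_gt0.
have a1 : a < 1.
  rewrite /a ltr_pdivrMr; last by lra.
  by rewrite ltr_pdivrMr // /t; lra.
have [c c0 ac] := power_le_expR a0 a1.
apply: (negligible_fiber (C := 1) (c := c) (d := 0)) => // g m mg.
rewrite mul1r expr0 mul1r -ac.
have [gm|gm] := leqP (10 * m) g; last first.
  rewrite (_ : [set H in NS g | _] = set0) ?cards0 ?mulr0 ?exprn_ge0 ?(ltW a0) //.
  by apply/setP => H; rewrite in_NS in_set0; case: eqP => [->|_] //=; rewrite ?andbF // leqNgt gm andbF.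
pose b := golden_conj R / t.
have b0 : 0 < b by rewrite divr_gt0.
apply: le_trans (@count_le_msum R (fun g H => 10 * mult H <= g)%N g m (iota 1 g) (iota 1 m.-1)
  (fun _ v => b^-1 ^+ v) (fun=> b ^+ g) _ _ _ _) _ => //.
- by move=> j v; rewrite exprn_ge0 ?invr_ge0 ?(ltW b0).
- by move=> y; rewrite exprn_ge0 ?(ltW b0).
- move=> H HN Hm _; split.
    by move=> i im; rewrite mem_iota add1n ltnS kunz_le // andbT kunz_gt0 // Hm.
  by rewrite (prod_kunz _ HN Hm) // -exprMn mulVf ?gt_eqF // expr1n.
rewrite msum_const.
have -> : \prod_(j <- iota 1 m.-1) \sum_(v <- iota 1 g) golden_conj R ^+ v * b^-1 ^+ v =
   (\sum_(v <- iota 1 g) t ^+ v) ^+ m.-1.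
  rewrite big_const_seq count_predT size_iota iter_mulr_1; congr (_ ^+ _).
  apply: eq_bigr => v _; rewrite -exprMn; congr (_ ^+ _).
  by rewrite /b invfM invrK mulrA divff ?mul1r // gt_eqF.
have T : \sum_(v <- iota 1 g) t ^+ v <= 7 / 3.
  have h : \sum_(v <- iota 1 g) t ^+ v <= \sum_(v <- iota 1 g) t ^+ v * (0 < v)%N%:R.
    by rewrite big_seq [leRHS]big_seq; apply: ler_sum => v; rewrite mem_iota => /andP[-> _]; rewrite mulr1.
  have := geometric_tail g 0 (ltW t0); rewrite expr1 /t in h * => h'; lra.
have T0 : 0 <= \sum_(v <- iota 1 g) t ^+ v.
  by apply: sumr_ge0 => v _; rewrite exprn_ge0 // ltW.
have bE : b = a * (11 / 12) by rewrite /a divfK //; lra.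
rewrite bE exprMn -mulrA ler_piMr ?exprn_ge0 ?(ltW a0) //.
apply: (@le_trans _ _ ((11 / 12) ^+ (10 * m) * (7 / 3) ^+ m)).
  apply: ler_pM; rewrite ?exprn_ge0 //; first by lra.
    by apply: ler_wiXn2l => //; lra.
  apply: (@le_trans _ _ ((7 / 3) ^+ m.-1)); first by rewrite lerXn2r ?nnegrE //; lra.
  by apply: ler_weXn2l; [lra | exact: leq_pred].
rewrite exprM -exprMn exprn_ile1 //; first by rewrite mulr_ge0 ?exprn_ge0; lra.
by lra.
Qed.

(** The pairs are disjoint, so they split off one at a time with [golden_pair]; an unpaired
    coordinate costs at most 1/z <= 2. *)
Lemma msum_pairs (R : rcfType) (PL : seq (nat * nat)) (rest : seq nat) (n : nat) y
    (s := flatten [seq [:: p.1; p.2] | p <- PL] ++ rest) :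
  uniq s ->
  msum (fun _ v => golden_conj R ^+ v) (iota 1 n) s
    (fun k => \prod_(p <- PL) (6 <= k p.1 + k p.2)%N%:R) y <=
  (33 / 34) ^+ size PL * 2 ^+ size rest.
Proof.
have z0 := golden_conj_ge0 R.
rewrite {}/s; elim: PL y => [|[i j] PL IH] y /=.
  move=> _; rewrite mul1r.
  under eq_msum do rewrite big_nil.
  rewrite msum_const mul1r big_const_seq count_predT iter_mulr_1.
  rewrite lerXn2r ?nnegrE ?sumr_ge0 // => [v _|]; first by rewrite exprn_ge0.
  exact: le_trans (golden_total R n) (golden_inv_le2 R).
set s := _ ++ rest in IH *; case/and3P.
rewrite inE negb_or => /andP[ij is_] js us.
have E w : msum (fun _ v => golden_conj R ^+ v) (iota 1 n) s
    (fun k => \prod_(p <- (i, j) :: PL) (6 <= k p.1 + k p.2)%N%:R) w =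
    (6 <= w i + w j)%N%:R * msum (fun _ v => golden_conj R ^+ v) (iota 1 n) s
    (fun k => \prod_(p <- PL) (6 <= k p.1 + k p.2)%N%:R) w.
  rewrite -(@msumZ _ _ _ _ _ (fun w => (6 <= w i + w j)%N%:R)).
    by apply: eq_msum => k; rewrite big_cons.
  move=> l ls k v; rewrite !upd_other //; by [apply: contraNneq is_ => -> | apply: contraNneq js => ->].
apply: (@le_trans _ _ (\sum_(a <- iota 1 n) \sum_(b <- iota 1 n)
   golden_conj R ^+ a * (golden_conj R ^+ b * (6 <= a + b)%N%:R) * ((33 / 34) ^+ size PL * 2 ^+ size rest))).
  apply: ler_sum => a _; rewrite big_distrr /=; apply: ler_sum => b _.
  rewrite E upd_same upd_other // upd_same -!mulrA ler_wpM2l ?exprn_ge0 //.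
  by rewrite ler_wpM2l ?exprn_ge0 // ler_wpM2l // IH.
under eq_bigr => a _ do rewrite -big_distrl /=.
rewrite -big_distrl /= exprS -mulrA ler_wpM2r ?golden_pair //.
by rewrite mulr_ge0 ?exprn_ge0 //; lra.
Qed.

Lemma card_has (T : finType) (I : Type) (A : pred T) (Q : T -> I -> bool) (s : seq I) :
  (#|[set x | A x && has (Q x) s]| <= \sum_(r <- s) #|[set x | A x && Q x r]|)%N.
Proof.
elim: s => [|r s IH].
  by rewrite big_nil leqn0 cards_eq0; apply/eqP/setP => x; rewrite !inE andbF.
rewrite big_cons; apply: leq_trans (leq_add (leqnn _) IH).
rewrite (_ : [set x | _] = [set x | A x && Q x r] :|: [set x | A x && has (Q x) s]).
  by rewrite cardsU leq_subr.
by apply/setP => x; rewrite !in_set /= andb_orr.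
Qed.

Lemma perm_pairs (T : eqType) (PL : seq (T * T)) :
  perm_eq (flatten [seq [:: p.1; p.2] | p <- PL]) (map fst PL ++ map snd PL).
Proof.
elim: PL => [//|p PL IH] /=; rewrite perm_cons.
by rewrite perm_sym -[p.2 :: map snd PL]cat1s perm_catCA /= perm_cons perm_sym.
Qed.

Lemma perm_cat_complement (T : eqType) (core s : seq T) :
  uniq core -> uniq s -> {subset core <= s} ->
  perm_eq (core ++ [seq i <- s | i \notin core]) s.
Proof.
move=> uc us cs; apply: uniq_perm => //.
  rewrite cat_uniq uc filter_uniq // andbT /=; apply/hasPn => x.
  by rewrite mem_filter => /andP[].
move=> x; rewrite mem_cat mem_filter; case: (boolP (x \in core)) => //= /cs.
by move=> ->.
Qed.

(** Below [r] the reflection is [i -> r - i], above it [i -> r + m - i]. Only [r] and the midpoints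
    [r / 2] and [(r + m) / 2], where integral, stay unpaired. *)
Lemma reflected_pairs (m r : nat) : (0 < r < m)%N ->
  exists PL : seq (nat * nat), [/\
    uniq (flatten [seq [:: p.1; p.2] | p <- PL]),
    {subset flatten [seq [:: p.1; p.2] | p <- PL] <= iota 1 m.-1},
    (m <= 2 * size PL + 4)%N &
    {in PL, forall p, [/\ (0 < p.1 < m)%N, (0 < p.2 < m)%N &
       (p.1 + p.2 = r)%N \/ (p.1 + p.2 = r + m)%N]}].
Proof.
move=> rm.
pose L1 := iota 1 (r.-1)./2; pose L2 := iota r.+1 (m.-1 - r)./2.
pose PL := [seq (i, r - i) | i <- L1]%N ++ [seq (i, r + m - i) | i <- L2]%N.
have mL1 i : (i \in L1) = (0 < i)%N && (2 * i < r)%N by rewrite mem_iota; lia.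
have mL2 i : (i \in L2) = (r < i)%N && (2 * i < r + m)%N by rewrite mem_iota; lia.
have PLp p : p \in PL -> [/\ (0 < p.1 < m)%N, (0 < p.2 < m)%N &
       (p.1 + p.2 = r)%N \/ (p.1 + p.2 = r + m)%N].
  rewrite mem_cat => /orP[] /mapP[i]; rewrite ?mL1 ?mL2 => h -> /=; split; lia.
exists PL; split => //; last by rewrite size_cat !size_map !size_iota; lia.
  have f1 : map fst PL = L1 ++ L2 by rewrite map_cat -!map_comp; congr (_ ++ _); exact: map_id.
  have f2 : map snd PL = [seq r - i | i <- L1]%N ++ [seq r + m - i | i <- L2]%N.
    by rewrite map_cat -!map_comp.
  rewrite (perm_uniq (perm_pairs _)) f1 f2.
  rewrite !cat_uniq !iota_uniq /= !map_inj_in_uniq ?iota_uniq; last first.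
  - by move=> i j; rewrite mL1 mL1 /=; lia.
  - by move=> i j; rewrite mL2 mL2 /=; lia.
  rewrite !andbT; apply/and3P; split.
  - by apply/hasPn => i; rewrite /= mL1 mL2; lia.
  - apply/hasPn => j; rewrite mem_cat => /orP[] /mapP[i]; rewrite ?mL1 ?mL2 => h ->;
      rewrite /= mem_cat mL1 mL2; lia.
  - apply/hasPn => j /mapP[i]; rewrite mL2 /= => h ->.
    by apply/negP => /mapP[i']; rewrite mL1 /=; lia.
move=> j; rewrite (perm_mem (perm_pairs _)) mem_cat mem_iota.
case/orP=> /mapP[p /PLp[h1 h2 _]] ->; lia.
Qed.

Lemma negligible_deep (R : realType) :
  negligible R (fun g H => (g < 10 * mult H)%N &&
    has (fun r => 7 <= kunz H r)%N (iota 1 (mult H).-1)).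
Proof.
have k0 : 0 < 33 / 34 :> R by lra. have k1 : 33 / 34 < 1 :> R by lra.
have [c c0 kc] := power_le_expR k0 k1.
have c20 : 0 < c / 2 by rewrite divr_gt0.
(* 8 = 2^3 covers up to three unpaired coordinates; [expR (2 * c)] and the rate [c / 2] come from
   [m <= 2 * size PL + 4]. *)
have C0 : 0 <= 8 * expR (2 * c) by rewrite mulr_ge0 ?expR_ge0.
apply: (negligible_by_mult (P := fun g H => has _ _) (d := 1) C0 c20) => g m m0.
have z0 := golden_conj_ge0 R.
apply: (@le_trans _ _ (\sum_(r <- iota 1 m.-1) golden_conj R ^+ g *
   #|[set H in NS g | (mult H == m) && (7 <= kunz H r)%N]|%:R)).
  rewrite -big_distrr /= ler_wpM2l ?exprn_ge0 // -natr_sum ler_nat.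
  have E r : [set H in NS g | (mult H == m) && (7 <= kunz H r)%N] =
     [set H : {set 'I_(2 * g)} | ((H \in NS g) && (mult H == m)) && (7 <= kunz H r)%N].
    by apply/setP => H; rewrite in_NS [RHS]in_set andbA.
  under eq_bigr => r _ do rewrite E.
  apply: leq_trans (card_has _ (fun H r => 7 <= kunz H r)%N _); rewrite subset_leq_card //.
  apply/subsetP => H; rewrite in_NS andbA => h; rewrite in_set; move: h.
  by case/andP => /andP[-> /eqP <-] ->; rewrite eqxx.
apply: (@le_trans _ _ (\sum_(r <- iota 1 m.-1) 8 * expR (2 * c) * expR (- (c / 2 * m%:R)))); last first.
  rewrite big_const_seq count_predT size_iota iter_addr_0 -[leLHS]mulr_natr expr1 -!mulrA.
  rewrite ler_wpM2l // ler_wpM2l ?expR_ge0 // mulrC ler_wpM2r ?expR_ge0 // ler_nat; lia.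
rewrite big_seq [leRHS]big_seq; apply: ler_sum => r; rewrite mem_iota => rI.
have rm : (0 < r < m)%N by lia.
have [PL [uPL sPL szPL PLp]] := reflected_pairs rm.
set core := flatten _ in uPL sPL.
have ps := perm_cat_complement uPL (iota_uniq 1 m.-1) sPL.
set rest := [seq _ <- _ | _] in ps.
have szr : (size rest <= 3)%N.
  have := perm_size ps; rewrite size_cat size_iota.
  rewrite (perm_size (perm_pairs PL)) size_cat !size_map; move: szPL m0; move: (size PL) (size rest) => a b; clear; lia.
apply: le_trans (@count_le_msum R (fun g H => 7 <= kunz H r)%N g m (iota 1 g) (core ++ rest)
  (fun _ _ => 1) (fun k => \prod_(p <- PL) (6 <= k p.1 + k p.2)%N%:R) ps _ _ _) _ => //.
- by move=> y; apply: prodr_ge0.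
- move=> H HN Hm Hr; split.
    by move=> i im; rewrite mem_iota add1n ltnS kunz_le // andbT kunz_gt0 // Hm.
  rewrite big1_eq mul1r big_seq big1 // => p /PLp[h1 h2 h3].
  suff -> : (6 <= kunz H p.1 + kunz H p.2)%N by [].
  (* A pair with sum [r] has coordinates adding up to at least 7; one that wraps around [m] still
     reaches 6. *)
  case: h3 => e.
    have := @kunz_add _ H p.1 p.2 HN; rewrite e Hm; lia.
  have [/andP[_ a] /andP[_ b]] := (h1, h2); have := @kunz_add_wrap _ H p.1 p.2 HN.
  rewrite e Hm addnK leq_addl => /(_ a b isT) h; move: Hr h; clear; lia.
rewrite (@eq_msum_weight _ _ (fun _ v => golden_conj R ^+ v)); last by move=> *; rewrite mulr1.
apply: le_trans (@msum_pairs R PL rest g (fun=> 0%N) _) _; first by rewrite (perm_uniq ps) iota_uniq.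
rewrite kc -/rest mulrC -mulrA -expRD; apply: ler_pM; rewrite ?exprn_ge0 ?expR_ge0 //.
  apply: (@le_trans _ _ (2 ^+ 3)); last by rewrite -natrX.
  by apply: ler_weXn2l szr; rewrite ler1n.
rewrite ler_expR.
have : (m%:R : R) <= 2 * (size PL)%:R + 4 by rewrite -natrM -natrD ler_nat.
by move: (m%:R : R) ((size PL)%:R : R) => x y; nra.
Qed.

(** * Depth between 3 and 6 *)

Definition level_total (R : rcfType) (l : nat) (u : R) : R :=
  \sum_(v <- iota 1 6) level_weight l u v.

Lemma level_total_bounds (R : rcfType) l (u : R) : (2 <= l)%N -> 0 <= u <= 1 ->
  1 <= level_total l u <= 2.
Proof.
move=> l2 /andP[u0 u1]; apply/andP; split.
  rewrite /level_total /= 2!big_cons.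
  rewrite {1 2}/level_weight (ltnW l2) l2 !mulr1 addrA expr1 golden_conj_sqr subrKC.
  by rewrite lerDl sumr_ge0 // => v _; exact: level_weight_ge0.
apply: le_trans (le_trans (golden_total R 6) (golden_inv_le2 R)).
apply: ler_sum => v _; rewrite /level_weight ler_piMr ?exprn_ge0 ?golden_conj_ge0 //.
by case: ifP.
Qed.

(** At level 2 the uncharged values 1 and 2 have total weight z + z^2 = 1; the remaining ones add
    less than [u]. *)
Lemma level_total2_le (R : rcfType) (u : R) : 0 <= u -> level_total 2 u <= 1 + u.
Proof.
move=> u0; have z2 := golden_conj_sqr R.
have [z3 z4 z5 z6] := golden_conj_powers R; have /andP[zl zh] := golden_conj_bounds R.
rewrite /level_total /level_weight !big_cons big_nil /= !mulr1 expr1 z2 z3 z4 z5 z6.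
have -> : golden_conj R + (1 - golden_conj R + ((2 * golden_conj R - 1) * u + ((2 - 3 * golden_conj R) * u +
  ((5 * golden_conj R - 3) * u + ((5 - 8 * golden_conj R) * u + 0))))) = 1 + (3 - 4 * golden_conj R) * u by ring.
rewrite lerD2l ler_piMl //; lra.
Qed.

Lemma msum_free (R : rcfType) (l : nat) (u : R) (s : seq nat) y :
  msum (fun _ => level_weight l u) (iota 1 6) s (fun=> 1) y = level_total l u ^+ size s.
Proof.
by rewrite msum_const mul1r big_const_seq count_predT iter_mulr_1.
Qed.

(** Each left vertex together with one right vertex yields the factor 19/20; a surplus right vertex
    costs at most its total weight, hence at most 2. *)
Lemma level_bipartite (R : rcfType) (l : nat) (u : R) (L S rs : seq nat) y :
  (3 <= l <= 6)%N -> 0 <= u <= 1 / 100 ->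
  uniq L -> uniq S -> {in L, forall i, i \notin S} ->
  uniq rs -> size rs = 4%N ->
  {in L & rs, forall i r, (i <= r)%N && (r - i \in S)%N} -> (size L <= size S)%N ->
  msum (fun _ => level_weight l u) (iota 1 6) (S ++ L)
    (fun k => \prod_(i <- L) (all (fun r => l <= k i + k (r - i)) rs)%N%:R) y <=
  2 ^+ (size S - size L) * (19 / 20) ^+ size L.
Proof.
move=> l36 u01 uL uS LS urs srs LrS LSsz; have /andP[u0 u1] := u01.
have /andP[W1 W2] : 1 <= level_total l u <= 2.
  by apply: level_total_bounds; [nat_lia | rewrite u0 (le_trans u1) //; lra].
have W0 : 0 < level_total l u by apply: lt_le_trans W1.
apply: le_trans (msum_bipartite (eta := 19 / 20) (N := 6) y _ W0 uL uS LS urs srs LrS _ _ _) _.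
- by move=> v; exact: level_weight_ge0.
- by move=> v; rewrite mem_iota; nat_lia.
- by lra.
- exact: level_biclique_weight.
rewrite -/(level_total l u) expr_div_n -{1}(subnK LSsz) exprD -mulrA.
rewrite [level_total l u ^+ size L * _]mulrC divfK ?expf_neq0 ?gt_eqF //.
rewrite ler_wpM2r ?exprn_ge0 //; first by lra.
by rewrite lerXn2r ?nnegrE ?(ltW W0).
Qed.

(* The four [r] in [rs] lie in a window of length [W] ending at [x]; reflection through them pairs [1..a] with [a+1..x-1]. *)
Lemma lower_region (R : rcfType) (l : nat) (u : R) (rs : seq nat) (W x : nat) y
    (a := ((x - W)./2).-1) :
  (3 <= l <= 6)%N -> 0 <= u <= 1 / 100 -> uniq rs -> size rs = 4%N ->
  {in rs, forall r, (r < x)%N /\ (x <= r + W)%N} ->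
  msum (fun _ => level_weight l u) (iota 1 6) (iota a.+1 (x.-1 - a) ++ iota 1 a)
    (fun k => \prod_(i <- iota 1 a) (all (fun r => l <= k i + k (r - i)) rs)%N%:R) y <=
  2 ^+ (W + 3) * (19 / 20) ^+ a.
Proof.
move=> l36 u01 urs srs rsx.
apply: le_trans (level_bipartite _ l36 u01 _ _ _ urs srs _ _) _; rewrite ?iota_uniq //.
- by move=> i; rewrite !mem_iota; nat_lia.
- by move=> i r; rewrite !mem_iota => iL /rsx [rx xr]; rewrite /a in iL *; nat_lia.
- by rewrite !size_iota /a; nat_lia.
rewrite !size_iota ler_wpM2r ?exprn_ge0 //; first by lra.
by apply: ler_weXn2l; [rewrite ler1n | rewrite /a; nat_lia].
Qed.

(* Reflection modulo [m] loses one unit of the level, so for [l = 2] nothing is left of the constraint and every coordinate is free. *)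
Lemma upper_region (R : rcfType) (l : nat) (u : R) (rs : seq nat) (W x m : nat) y
    (c := uphalf (x + m)) (b := (m - W - c)%N) :
  (2 <= l <= 6)%N -> 0 <= u <= 1 / 100 -> uniq rs -> size rs = 4%N -> (x <= m)%N ->
  {in rs, forall r, (r < x)%N /\ (x <= r + W)%N} ->
  msum (fun _ => level_weight l u) (iota 1 6)
    (iota (c + b) (m - (c + b)) ++ (iota x (c - x) ++ iota c b))
    (fun k => if (2 < l)%N then
       \prod_(i <- iota c b) (all (fun r => l <= k i + k (r - i)) [seq r + m | r <- rs])%N%:R else 1) y <=
  4 ^+ (W + 1) * (1 + u) ^+ m.
Proof.
move=> l26 u01 urs srs xm rsx; have /andP[u0 u1] := u01.
have u1' : 0 <= u <= 1 by rewrite u0 (le_trans u1) //; lra.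
have /andP[W1 W2] : 1 <= level_total l u <= 2 by apply: level_total_bounds; [nat_lia|].
have U1 : 1 <= (1 + u) ^+ m by rewrite exprn_ege1 // lerDl.
have [l2|l2] := leqP l 2.
  have -> : l = 2%N by nat_lia.
  rewrite msum_free !size_cat !size_iota.
  apply: (@le_trans _ _ ((1 + u) ^+ m)).
    apply: (@le_trans _ _ ((1 + u) ^+ (m - (c + b) + (c - x + b)))).
      rewrite lerXn2r ?nnegrE ?level_total2_le ?addr_ge0 //.
      by have /andP[h _] := @level_total_bounds R 2 u isT u1'; rewrite (le_trans _ h).
    by apply: ler_weXn2l; [rewrite lerDl | rewrite /b /c; nat_lia].
  by rewrite ler_peMl ?(le_trans _ U1) // exprn_ege1 // ler1n.
rewrite msum_cat.
have ge0 : 0 <= level_total l u by rewrite (le_trans _ W1).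
have lw0 v : 0 <= level_weight l u v by exact: level_weight_ge0.
pose B : R := 2 ^+ (W + 1).
apply: (@le_trans _ _ (msum (fun _ => level_weight l u) (iota 1 6)
   (iota (c + b) (m - (c + b))) (fun=> B) y)).
  apply: ler_msum => // w.
  apply: le_trans (level_bipartite _ _ u01 _ _ _ _ _ _ _) _; rewrite ?iota_uniq ?size_map //.
  - by rewrite l2; case/andP: l26.
  - by move=> i; rewrite !mem_iota; nat_lia.
  - by rewrite map_inj_uniq // => i j; nat_lia.
  - move=> i r'; rewrite !mem_iota => iL /mapP[r /rsx [rx xr] ->]; rewrite /b /c in iL *; nat_lia.
  - by rewrite !size_iota /b /c; nat_lia.
  rewrite !size_iota /B -[leRHS]mulr1; apply: ler_pM; rewrite ?exprn_ge0 //; first by lra.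
    by apply: ler_weXn2l; [rewrite ler1n | rewrite /b /c; nat_lia].
  by rewrite exprn_ile1 //; lra.
rewrite msum_const big_const_seq count_predT iter_mulr_1 size_iota -/(level_total l u).
rewrite -[leLHS]mulr1; apply: ler_pM => //; first by rewrite mulr_ge0 ?exprn_ge0.
(* One factor pays for the surplus right vertices, the other for the coordinates from [c + b] on,
   whose reflections may fall below [x] and which are left unconstrained. *)
have -> : 4 ^+ (W + 1) = B * 2 ^+ (W + 1) by rewrite /B -exprMn; congr (_ ^+ _); ring.
rewrite ler_wpM2l ?exprn_ge0 //.
apply: (@le_trans _ _ (2 ^+ (m - (c + b)))); first by rewrite lerXn2r ?nnegrE.
by apply: ler_weXn2l; [rewrite ler1n | rewrite /b /c; nat_lia].
Qed.

Lemma prod_if_count (R : comNzRingType) (I : Type) (s : seq I) (P : pred I) (u : R) :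
  \prod_(j <- s) (if P j then 1 else u) = u ^+ count (predC P) s.
Proof.
elim: s => [|j s IH]; first by rewrite big_nil.
by rewrite big_cons IH /=; case: (P j); rewrite ?mul1r ?add0n // add1n exprS.
Qed.

Definition cluster_pred (m q W N T x : nat) (rs : seq nat) : gapset_pred := fun g H =>
  [&& all (fun i => kunz H i <= 6)%N (iota 0 m), all (fun r => q <= kunz H r)%N rs,
      (count (fun i => q <= kunz H i)%N (iota x (m - x)) <= T)%N &
      (count (fun i => q < kunz H i)%N (iota 0 m) <= N)%N].

(** Coordinates below [x] are weighted at level [q] with charge [u], the others at level [q - 1]
    with charge [u']. The first part decays by [lower_region], the second is nearly neutral by
    [upper_region], and the negative powers of [u] and [u'] repay the at most [N] and [T] charged
    values. *)
Lemma cluster_count (R : realType) (g m q W N T x : nat) (rs : seq nat) (u u' : R) :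
  (3 <= q <= 6)%N -> 0 < u <= 1 / 100 -> 0 < u' <= 1 / 100 -> (x <= m)%N ->
  uniq rs -> size rs = 4%N -> {in rs, forall r, (r < x)%N /\ (x <= r + W)%N} ->
  golden_conj R ^+ g *
    #|[set H in NS g | (mult H == m) && cluster_pred m q W N T x rs H]|%:R <=
  u ^- N * u' ^- T *
  (2 ^+ (W + 3) * (19 / 20) ^+ ((x - W)./2).-1 * (4 ^+ (W + 1) * (1 + u') ^+ m)).
Proof.
move=> q36 /andP[u0 u1] /andP[v0 v1] xm urs srs rsx.
set a := ((x - W)./2).-1; pose c := uphalf (x + m); pose b := (m - W - c)%N.
pose s1 := iota a.+1 (x.-1 - a) ++ iota 1 a.
pose s2 := iota (c + b) (m - (c + b)) ++ (iota x (c - x) ++ iota c b).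
have x0 : (0 < x)%N by case: (rs) srs rsx => // r rs' _ /(_ r (mem_head _ _)) []; nat_lia.
have p1 : perm_eq s1 (iota 1 x.-1).
  rewrite /s1 perm_catC; have -> : x.-1 = (a + (x.-1 - a))%N by rewrite /a; nat_lia.
  by rewrite addKn iotaD add1n.
have p2 : perm_eq s2 (iota x (m - x)).
  rewrite /s2 perm_catC.
  have -> : (m - x = (c - x) + b + (m - (c + b)))%N by rewrite /b /c; nat_lia.
  have e1 : (x + (c - x) = c)%N by rewrite /c; nat_lia.
  have e2 : (x + (c - x + b) = c + b)%N by rewrite addnA e1.
  by rewrite iotaD e2 (iotaD x) e1.
have ps : perm_eq (s2 ++ s1) (iota 1 m.-1).
  rewrite perm_catC (_ : m.-1 = x.-1 + (m - x))%N; last by nat_lia.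
  by rewrite iotaD add1n prednK // perm_cat.
pose e (j v : nat) : R := if (j < x)%N then (if (v <= q)%N then 1 else u)
  else (if (v <= q.-1)%N then 1 else u').
pose FA (k : nat -> nat) : R := \prod_(i <- iota 1 a) (all (fun r => q <= k i + k (r - i)) rs)%N%:R.
pose FB (k : nat -> nat) : R := if (2 < q.-1)%N then
   \prod_(i <- iota c b) (all (fun r => q.-1 <= k i + k (r - i)) [seq r + m | r <- rs])%N%:R else 1.
have FA0 k : 0 <= FA k by apply: prodr_ge0.
have FB0 k : 0 <= FB k by rewrite /FB; case: ifP => // _; apply: prodr_ge0.
have u'0 := ltW u0; have v'0 := ltW v0.
have le1 (w : R) : w <= 1 / 100 -> w <= 1 by move=> h; lra.
apply: le_trans (@count_le_msum R (cluster_pred m q W N T x rs) g m (iota 1 6) (s2 ++ s1) e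
  (fun k => (u ^- N * u' ^- T) * (FB k * FA k)) ps _ _ _) _.
- by move=> j v; rewrite /e; case: ifP => _; case: ifP.
- by move=> k; rewrite !mulr_ge0 ?invr_ge0 ?exprn_ge0.
- move=> H HN Hm /and4P[/allP k6 /allP kr cT cN]; split.
    move=> i im; rewrite mem_iota kunz_gt0 ?Hm //= add1n ltnS k6 // mem_iota; nat_lia.
  have -> : FA (kunz H) = 1.
    rewrite /FA big_seq big1 // => i iI.
    suff -> : all (fun r => q <= kunz H i + kunz H (r - i))%N rs by [].
    apply/allP => r rr; apply: leq_trans (kr r rr) _.
    have [rx xr] := rsx r rr; rewrite mem_iota in iI.
    have ir : (i <= r)%N by rewrite /a in iI; nat_lia.
    by rewrite -{1}(subnKC ir) kunz_add // Hm; nat_lia.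
  have -> : FB (kunz H) = 1.
    rewrite /FB; case: ifP => // _; rewrite big_seq big1 // => i iI.
    suff -> : all (fun r => q.-1 <= kunz H i + kunz H (r - i))%N [seq r + m | r <- rs]%N by [].
    apply/allP => _ /mapP[r rr ->]; have [rx xr] := rsx r rr; rewrite mem_iota in iI.
    have := @kunz_add_wrap _ H i (r + m - i) HN; rewrite Hm.
    have im : (i < m)%N by rewrite /b in iI; nat_lia.
    have jm : (r + m - i < m)%N by rewrite /b /c in iI; nat_lia.
    rewrite subnKC; last by nat_lia.
    by move=> /(_ im jm (leq_addl _ _)); rewrite addnK; have := kr r rr; nat_lia.
  rewrite !mulr1 (perm_big _ ps) /=.
  rewrite (_ : m.-1 = x.-1 + (m - x))%N; last by nat_lia.
  rewrite iotaD add1n prednK // big_cat /=.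
  have -> : \prod_(j <- iota 1 x.-1) e j (kunz H j) =
     u ^+ count (fun j => q < kunz H j)%N (iota 1 x.-1).
    rewrite [RHS](_ : _ = \prod_(j <- iota 1 x.-1) if (kunz H j <= q)%N then 1 else u).
      rewrite big_seq [RHS]big_seq; apply: eq_bigr => j; rewrite mem_iota /e => jI.
      by rewrite ifT //; nat_lia.
    by rewrite prod_if_count; congr (_ ^+ _); apply: eq_count => j /=; nat_lia.
  have -> : \prod_(j <- iota x (m - x)) e j (kunz H j) =
     u' ^+ count (fun j => q <= kunz H j)%N (iota x (m - x)).
    rewrite [RHS](_ : _ = \prod_(j <- iota x (m - x)) if (kunz H j <= q.-1)%N then 1 else u').
      rewrite big_seq [RHS]big_seq; apply: eq_bigr => j; rewrite mem_iota /e => jI.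
      by rewrite ifF //; nat_lia.
    by rewrite prod_if_count; congr (_ ^+ _); apply: eq_count => j /=; nat_lia.
  set n1 := count _ _; set n2 := count _ _.
  have n1N : (n1 <= N)%N.
    apply: leq_trans cN; rewrite /n1 (_ : m = 1 + x.-1 + (m - x))%N; last by nat_lia.
    by rewrite !iotaD !count_cat -addnA addnCA leq_addr.
  rewrite mulrACA -[1]mulr1; apply: ler_pM => //.
    by rewrite ler_pdivlMr ?exprn_gt0 // mul1r ler_wiXn2l // le1.
  by rewrite ler_pdivlMr ?exprn_gt0 // mul1r ler_wiXn2l // le1.
have z0 := golden_conj_ge0 R.
rewrite msumZl ler_wpM2l ?mulr_ge0 ?invr_ge0 ?exprn_ge0 // msum_cat.
have lu : 0 <= u <= 1 / 100 by rewrite u'0.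
have lu' : 0 <= u' <= 1 / 100 by rewrite v'0.
have lwz j v : 0 <= golden_conj R ^+ v * e j v.
  by rewrite mulr_ge0 ?exprn_ge0 // /e; case: ifP => _; case: ifP.
set A := 2 ^+ _ * _.
apply: (@le_trans _ _ (msum (fun j v => golden_conj R ^+ v * e j v) (iota 1 6) s2 (fun k => A * FB k) (fun=> 0%N))).
  (* [FB] reads only coordinates from [x] on, so it is constant in the inner sum and the two regions
     separate. *)
  apply: ler_msum => // w; rewrite msumZ; last first.
    move=> j; rewrite (perm_mem p1) mem_iota => jI k v; rewrite /FB; case: ifP => // _.
    rewrite big_seq [RHS]big_seq; apply: eq_bigr => i; rewrite mem_iota => iI.
    congr (_%:R); congr nat_of_bool; apply: eq_in_all => _ /mapP[r rr ->].
    have [rx xr] := rsx r rr; rewrite !upd_other //; rewrite /b /c in iI; nat_lia.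
  rewrite mulrC ler_wpM2r //.
  rewrite (@eq_msum_weight _ _ (fun _ => level_weight q u)); last first.
    move=> j v; rewrite (perm_mem p1) mem_iota => jI _; rewrite /e /level_weight ifT //; nat_lia.
  exact: lower_region.
rewrite msumZl ler_wpM2l //; first by rewrite mulr_ge0 ?exprn_ge0 //; lra.
rewrite (@eq_msum_weight _ _ (fun _ => level_weight q.-1 u')); last first.
  move=> j v; rewrite (perm_mem p2) mem_iota => jI _; rewrite /e /level_weight ifF //; nat_lia.
apply: upper_region => //; nat_lia.
Qed.

(** * Union bound over clusters of large coordinates *)

Definition nlevel (g : nat) (H : {set 'I_(2 * g)}) (v : nat) : nat :=
  count (fun i => v <= kunz H i)%N (iota 0 (mult H)).

Fixpoint words (T : Type) (V : seq T) (n : nat) : seq (seq T) :=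
  if n is n'.+1 then [seq v :: w | v <- V, w <- words V n'] else [:: [::]].

Lemma size_words (T : Type) (V : seq T) n : size (words V n) = (size V ^ n)%N.
Proof. by elim: n => [//|n IH] /=; rewrite size_allpairs IH expnS. Qed.

Lemma mem_words (T : eqType) (V : seq T) (w : seq T) :
  {subset w <= V} -> w \in words V (size w).
Proof.
elim: w => [//|v w IH] wV /=; apply: allpairs_f; first by apply: wV; rewrite mem_head.
by apply: IH => x xw; apply: wV; rewrite in_cons xw orbT.
Qed.

Lemma exists_nat_ge (R : realType) (x : R) : exists2 n : nat, (0 < n)%N & x <= n%:R.
Proof.
exists (Num.truncn x).+1 => //; apply/ltW; exact: truncnS_gt.
Qed.

(** Gathers the conditions that do not mention the semigroup. For [W] large compared with [K], the
    last one forces [x] to be a positive proportion of [m], up to a bounded amount. *)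
Definition cluster_valid (m K W : nat) (p : nat * seq nat) : bool :=
  [&& uniq p.2, size p.2 == 4%N, all (fun r => (r < p.1) && (p.1 <= r + W))%N p.2 &
      (p.1 <= m)%N && (m <= K * (p.1 + 3 * (m %/ W).+1))%N].

Definition level_gap_pred (q K K' : nat) : gapset_pred := fun g H =>
  [&& all (fun i => kunz H i <= 6)%N (iota 0 (mult H)),
      (mult H <= K * nlevel H q)%N & (K' * nlevel H q.+1 <= mult H)%N].

Lemma exists_cluster (g m q K K' W : nat) (H : {set 'I_(2 * g)}) :
  (0 < W)%N -> (0 < K)%N -> (0 < K')%N ->
  mult H = m -> (3 * (m %/ W).+1 < nlevel H q)%N -> level_gap_pred q K K' H ->
  has (fun p : nat * seq nat => cluster_valid m K W p &&
         cluster_pred m q W (m %/ K') (3 * (m %/ W).+1) p.1 p.2 H)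
    [seq (x, rs) | x <- iota 0 m.+1, rs <- words (iota 0 m) 4].
Proof.
move=> W0 K0 K'0 Hm; rewrite /level_gap_pred /nlevel Hm => n3 /and3P[k6 mK K'm].
have mW : (m <= (m %/ W).+1 * W)%N by rewrite ltnW // ltn_ceil.
have [x [rs [xm cx ct [urs srs] rsP]]] := dense_cluster mW n3.
apply/hasP; exists (x, rs).
  apply: allpairs_f; first by rewrite mem_iota.
  rewrite -srs mem_words // => r /rsP[_ rx _]; rewrite mem_iota; lia.
rewrite /cluster_valid /cluster_pred /= urs srs xm eqxx k6 ct /=.
have -> : all (fun r => (r < x) && (x <= r + W))%N rs.
  by apply/allP => r /rsP[_ -> ->].
have -> : all (fun r => q <= kunz H r)%N rs by apply/allP => r /rsP[].
rewrite /= (leq_trans mK) ?leq_mul2l ?cx ?orbT //=.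
by rewrite leq_divRL // mulnC.
Qed.

(** Union bound: a position [x] and four coordinates can be chosen in at most [(m + 1) ^ 5] ways. *)
Lemma card_cluster (R : realType) (g m q K K' W : nat) (u u' B : R) :
  (3 <= q <= 6)%N -> 0 < u <= 1 / 100 -> 0 < u' <= 1 / 100 ->
  (0 < W)%N -> (0 < K)%N -> (0 < K')%N -> (3 * K * (m %/ W).+1 < m)%N -> 0 <= B ->
  (forall x, (m <= K * (x + 3 * (m %/ W).+1))%N ->
     u ^- (m %/ K') * u' ^- (3 * (m %/ W).+1) *
       (2 ^+ (W + 3) * (19 / 20) ^+ ((x - W)./2).-1 * (4 ^+ (W + 1) * (1 + u') ^+ m)) <= B) ->
  golden_conj R ^+ g *
    #|[set H in NS g | (mult H == m) && level_gap_pred q K K' H]|%:R <= (m.+1)%:R ^+ 5 * B.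
Proof.
move=> q36 u01 u'01 W0 K0 K'0 mbig B0 HB; have z0 := golden_conj_ge0 R.
pose Ch := [seq (x, rs) | x <- iota 0 m.+1, rs <- words (iota 0 m) 4].
pose Q (H : {set 'I_(2 * g)}) (p : nat * seq nat) := cluster_valid m K W p &&
         cluster_pred m q W (m %/ K') (3 * (m %/ W).+1) p.1 p.2 H.
apply: (@le_trans _ _ (\sum_(p <- Ch) golden_conj R ^+ g *
    #|[set H : {set 'I_(2 * g)} | ((H \in NS g) && (mult H == m)) && Q H p]|%:R)).
  rewrite -big_distrr /= ler_wpM2l ?exprn_ge0 // -natr_sum ler_nat.
  apply: leq_trans (@card_has _ _ (fun H => (H \in NS g) && (mult H == m)) Q Ch); rewrite subset_leq_card //.
  apply/subsetP => H; rewrite in_NS => /and3P[HN /eqP Hm HP]; rewrite in_set HN Hm eqxx /=.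
  apply: exists_cluster => //.
  move: HP; rewrite /level_gap_pred Hm => /and3P[_ mK _].
  by rewrite -(ltn_pmul2l K0) mulnCA mulnA (leq_trans mbig).
apply: (@le_trans _ _ (\sum_(p <- Ch) B)).
  apply: ler_sum => -[x rs] _; have [val|nv] := boolP (cluster_valid m K W (x, rs)); last first.
    rewrite (_ : [set H | _] = set0) ?cards0 ?mulr0 //.
    by apply/setP => H; rewrite in_set in_set0 /Q (negbTE nv) andbF.
  have /and4P[/= urs /eqP srs rsP /andP[xm mK]] := val.
  apply: le_trans (HB x mK); have rsx : {in rs, forall r, (r < x)%N /\ (x <= r + W)%N}.
    by move=> r rr; have /andP[] := allP rsP r rr.
  apply: le_trans (@cluster_count R g m q W (m %/ K') (3 * (m %/ W).+1) x rs u u' q36 u01 u'01 xm urs srs rsx).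
  rewrite ler_wpM2l ?exprn_ge0 // ler_nat subset_leq_card //.
  by apply/subsetP => H; rewrite in_NS in_set => /andP[/andP[-> ->] /andP[_ ->]].
rewrite big_const_seq count_predT iter_addr_0 -[leLHS]mulr_natl ler_wpM2r //.
rewrite /Ch size_allpairs size_words !size_iota -natrX ler_nat (expnS _ 4) leq_mul2l /=.
by rewrite leq_exp2r.
Qed.

(** A crude bound for the finitely many small multiplicities, from total weight at most 1/z <= 2 per
    coordinate. *)
Lemma card_mult_le (R : realType) (P : gapset_pred) (g m : nat) :
  golden_conj R ^+ g * #|[set H in NS g | (mult H == m) && P g H]|%:R <= 2 ^+ m.
Proof.
have z0 := golden_conj_ge0 R.
apply: le_trans (@count_le_msum R P g m (iota 1 g) (iota 1 m.-1) (fun _ _ => 1) (fun=> 1) _ _ _ _) _ => //.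
  move=> H HN Hm _; split; last by rewrite big1_eq mul1r.
  by move=> i im; rewrite mem_iota add1n ltnS kunz_le // andbT kunz_gt0 // Hm.
rewrite msum_const mul1r big_const_seq count_predT iter_mulr_1 size_iota.
under eq_bigr do rewrite mulr1.
apply: (@le_trans _ _ (2 ^+ m.-1)); last by apply: ler_weXn2l; [rewrite ler1n | exact: leq_pred].
rewrite lerXn2r ?nnegrE ?sumr_ge0 // => [v _|]; first by rewrite exprn_ge0.
exact: le_trans (golden_total R g) (golden_inv_le2 R).
Qed.

(* [K'] is chosen after [K] and the window length [W]: the factor u^(-m/K') paid for the exceptional coordinates must stay below the exponential gain from the cluster. *)
Lemma negligible_cluster (R : realType) (q K : nat) : (3 <= q <= 6)%N -> (0 < K)%N ->
  exists2 K' : nat, (0 < K')%N &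
    negligible R (fun g H => (g < 10 * mult H)%N && level_gap_pred q K K' H).
Proof.
move=> q36 K0; have KR : 0 < K%:R :> R by rewrite ltr0n.
pose u : R := 1 / 100; have u0 : 0 < u by rewrite /u; lra.
have a0 : 0 < 19 / 20 :> R by lra. have a1 : 19 / 20 < 1 :> R by lra.
have [al al0 alE] := power_le_expR a0 a1.
have u1 : u < 1 by rewrite /u; lra.
have [be be0 beE] := power_le_expR u0 u1.
(* The unit of the budget. Since [al = 16 * w * K], the cluster gains [7 * w * m] up to a constant,
   while the charges [u], the charges [u'] and the factor [(1 + u') ^+ m] lose at most [w * m] each,
   again up to a constant; the rate [4 * w] remains. *)
pose w : R := al / (16 * K%:R).
have w0 : 0 < w by rewrite divr_gt0 // mulr_gt0.
pose u' : R := Num.min u w.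
have u'0 : 0 < u' by rewrite lt_min u0.
have u'u : u' <= u by rewrite ge_min lexx.
have u'w : u' <= w by rewrite ge_min lexx orbT.
have [be' be'0 be'E] := power_le_expR u'0 (le_lt_trans u'u u1).
(* [24 * K] keeps the term [3 * (m %/ W)] small in the lower bound for [x]; [3 * be' / w] pays for
   up to three values at least [q] in each window passed. *)
have [W W0 HW] := exists_nat_ge (24 * K%:R + 3 * be' / w).
have [K' K'0 HK'] := exists_nat_ge (be / w).
have w0' : w != 0 by rewrite gt_eqF.
exists K' => //.
pose C0 : R := 2 ^+ (W + 3) * 4 ^+ (W + 1) * expR (3 * be' + al * (W%:R + 8)).
have C00 : 0 <= C0 by rewrite !mulr_ge0 ?exprn_ge0 ?expR_ge0.
(* Up to [M] the crude bound suffices; beyond it there are enough coordinates at least [q] to fill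
   some window with four. *)
pose M := (24 * K)%N.
pose C : R := C0 + 2 ^+ M * expR (4 * w * M%:R).
have C'0 : 0 <= 2 ^+ M * expR (4 * w * M%:R) by rewrite mulr_ge0 ?exprn_ge0 ?expR_ge0.
have C1 : 0 <= C by rewrite addr_ge0.
have w40 : 0 < 4 * w by rewrite mulr_gt0.
apply: (negligible_by_mult (d := 5) C1 w40) => g m m0.
have p1 : 1 <= (m.+1)%:R ^+ 5 :> R by rewrite exprn_ege1 // ler1n.
have [mM|Mm] := leqP m M.
  apply: le_trans (card_mult_le _ _ _ _) _; rewrite /C mulrDl mulrDl -[leLHS]add0r lerD //.
    by rewrite !mulr_ge0 ?exprn_ge0 ?expR_ge0.
  apply: (@le_trans _ _ (2 ^+ M * ((m.+1)%:R ^+ 5 * (expR (4 * w * M%:R) * expR (- (4 * w * m%:R)))))); last first.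
    by rewrite le_eqVlt; apply/orP; left; apply/eqP; ring.
  rewrite -expRD -[leLHS]mulr1; apply: ler_pM; rewrite ?exprn_ge0 //.
    by apply: ler_weXn2l => //; rewrite ler1n.
  rewrite -[leLHS]mulr1; apply: ler_pM => //.
  rewrite -[leLHS]expR0 ler_expR -mulrBr mulr_ge0 ?(ltW w40) // subr_ge0 ler_nat //.
apply: (@le_trans _ _ ((m.+1)%:R ^+ 5 * (C0 * expR (- (4 * w * m%:R))))); last first.
  rewrite mulrCA mulrA ler_wpM2r ?expR_ge0 // ler_wpM2r ?exprn_ge0 //.
  by rewrite /C lerDl C'0.
have WK : (24 * K <= W)%N.
  rewrite -(ler_nat R) natrM; apply: le_trans HW; rewrite lerDl.
  by apply: divr_ge0; [apply: mulr_ge0 => //; exact: ltW | exact: ltW].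
have wW : 3 * be' <= w * W%:R.
  by rewrite [leRHS]mulrC -ler_pdivrMr //; apply: le_trans HW; rewrite lerDr mulr_ge0.
have wK' : be <= w * K'%:R by rewrite mulrC -ler_pdivrMr.
have alw : al = 16 * w * K%:R by rewrite /w; field; rewrite gt_eqF.
set d := (m %/ W)%N; have dW : (d * W <= m)%N by exact: leq_trunc_div.
have dK : (24 * K * d <= m)%N by rewrite (leq_trans _ dW) // mulnC leq_mul2l WK orbT.
have mbig : (3 * K * d.+1 < m)%N by move: Mm dK; rewrite /M; clear; nia.
have u01 : 0 < u <= 1 / 100 by rewrite u0 lexx.
have u'01 : 0 < u' <= 1 / 100 by rewrite u'0.
apply: (card_cluster _ q36 u01 u'01 W0 K0 K'0 mbig); first by rewrite mulr_ge0 ?expR_ge0.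
move=> x; rewrite -/d => mx; set n1 := (m %/ K')%N; set a := ((x - W)./2).-1.
have n1K : (n1 * K' <= m)%N by exact: leq_trunc_div.
have aW : (x <= 2 * a + W + 3)%N by rewrite /a; clear; lia.
rewrite beE be'E alE -!expRN !opprK.
have um : (1 + u') ^+ m <= expR (u' * m%:R).
  rewrite mulrC expRM_natl lerXn2r ?nnegrE ?expR_ge0 ?expR_ge1Dx //.
  by rewrite addr_ge0 // ltW.
apply: (@le_trans _ _ (expR (be * n1%:R) * expR (be' * (3 * d.+1)%:R) *
   (2 ^+ (W + 3) * expR (- (al * a%:R)) * (4 ^+ (W + 1) * expR (u' * m%:R))))).
  by rewrite !(ler_wpM2l, mulr_ge0, expR_ge0, exprn_ge0).
have -> : expR (be * n1%:R) * expR (be' * (3 * d.+1)%:R) *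
   (2 ^+ (W + 3) * expR (- (al * a%:R)) * (4 ^+ (W + 1) * expR (u' * m%:R))) =
   2 ^+ (W + 3) * 4 ^+ (W + 1) * (expR (be * n1%:R) * expR (be' * (3 * d.+1)%:R) *
   expR (- (al * a%:R)) * expR (u' * m%:R)) by ring.
rewrite /C0 -[leRHS]mulrA -!expRD ler_wpM2l ?mulr_ge0 ?exprn_ge0 // ler_expR.
move: mx dK dW n1K aW; rewrite -!(ler_nat R) !natrD !natrM => mx dK dW n1K aW.
have dE : (d.+1)%:R = d%:R + 1 :> R by rewrite -addn1 natrD.
rewrite natrD natrM dE in mx; rewrite dE.
move: mx dK dW n1K aW wW wK' u'w; move: (m%:R : R) (ler0n R m) => mR mR0.
move: (n1%:R : R) (ler0n R n1) (K'%:R : R) (d%:R : R) (ler0n R d) => n1R n0 K'R dR d0.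
move: (a%:R : R) (W%:R : R) (ler0n R W) (x%:R : R) => aR WR W00 xR mx dK dW n1K aW wW wK' u'w.
move: (K%:R : R) KR alw mx dK => KR KR0 -> mx dK; clear -w0 n0 d0 mR0 W00 KR0 mx dK dW n1K aW wW wK' u'w.
have p1 : be * n1R <= w * mR.
  apply: (@le_trans _ _ (w * K'R * n1R)); first by rewrite ler_wpM2r.
  by rewrite -mulrA ler_wpM2l ?(ltW w0) // mulrC.
have p2 : 3 * be' * dR <= w * mR.
  apply: (@le_trans _ _ (w * WR * dR)); first by rewrite ler_wpM2r.
  by rewrite -mulrA ler_wpM2l ?(ltW w0) // mulrC.
have p3 : u' * mR <= w * mR by rewrite ler_wpM2r.
have p4 : w * (KR * (xR + 3 * (dR + 1))) >= w * mR by rewrite ler_wpM2l ?(ltW w0).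
have p5 : w * (24 * KR * dR) <= w * mR by rewrite ler_wpM2l ?(ltW w0).
have wK0 : 0 <= w * KR by rewrite mulr_ge0 ?(ltW w0) ?(ltW KR0).
have p6 : w * KR * xR <= w * KR * (aR + (aR + 0) + WR + 3) by rewrite ler_wpM2l.
have p7 : 0 <= w * KR * WR by rewrite mulr_ge0.
lra.
Qed.

(** * Concentration for almost depth-2 semigroups *)

(** From [1 - x <= expR (- x)] one gets [expR x <= (1 - x)^-1], and [(1 + x + 2 * x ^+ 2) * (1 - x)
    = 1 + x ^+ 2 * (1 - 2 * x)] is at least 1. *)
Lemma expR_le_quadratic (R : realType) (x : R) : `|x| <= 1 / 2 -> expR x <= 1 + x + 2 * x ^+ 2.
Proof.
rewrite ler_norml => /andP[xl xh].
have h : 1 - x <= expR (- x) := expR_ge1Dx (- x).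
have x1 : 0 < 1 - x by lra.
apply: (@le_trans _ _ (1 - x)^-1).
  by rewrite -[x in expR x]opprK expRN lef_pV2 ?posrE ?expR_gt0.
rewrite -div1r ler_pdivrMr //.
have : 0 <= x ^+ 2 * (1 - 2 * x) by rewrite mulr_ge0 ?sqr_ge0 //; lra.
lra.
Qed.

Definition centered (R : realType) (v : nat) : R := v%:R - 1 - golden_conj R ^+ 2.

(* With probabilities z and z^2 for the values 1 and 2, [centered] has mean zero, so the tilted weight is 1 + O(s^2). *)
Lemma tilted_total (R : realType) (s a : R) (z := golden_conj R) :
  0 <= s <= 1 / 10 -> `|a| <= 1 ->
  \sum_(v <- iota 1 6) z ^+ v * ((if (v <= 2)%N then 1 else s ^+ 2) * expR (s * (a * centered R v)))
    <= expR (4 * s ^+ 2).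
Proof.
move=> /andP[s0 s1] a1.
have z0 := golden_conj_gt0 R; have z2 := golden_conj_sqr R; rewrite -/z in z0 z2.
have [z3 z4 z5 z6] := golden_conj_powers R; have /andP[zl zh] := golden_conj_bounds R.
rewrite -/z in z3 z4 z5 z6 zl zh.
have small x : `|x| <= 1 -> expR (s * (a * x)) <= 1 + s * (a * x) + 2 * s ^+ 2.
  move=> x1; have ax : `|a * x| <= 1 by rewrite normrM mulr_ile1.
  have sax : `|s * (a * x)| <= s by rewrite normrM (ger0_norm s0) ler_piMr.
  apply: le_trans (expR_le_quadratic _) _; first by apply: le_trans sax _; lra.
  rewrite lerD2l ler_wpM2l // exprMn ler_piMr ?sqr_ge0 //.
  by rewrite -[_ ^+ 2]ger0_norm ?sqr_ge0 // normrX exprn_ile1.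
have big x : `|x| <= 5 -> expR (s * (a * x)) <= 2.
  move=> x5; have ax : `|a * x| <= 5 by rewrite normrM -[leRHS]mul1r ler_pM.
  have sax : s * (a * x) <= 1 / 2.
    apply: le_trans (ler_norm _) _; rewrite normrM (ger0_norm s0).
    by apply: (@le_trans _ _ (1 / 10 * 5)); [exact: ler_pM | lra].
  apply: (@le_trans _ _ (expR (1 / 2))); first by rewrite ler_expR.
  apply: le_trans (expR_le_quadratic _) _; first by rewrite ger0_norm //; lra.
  lra.
have c1 : centered R 1 = - (1 - z) by rewrite /centered -/z z2; lra.
have c2 : centered R 2 = z by rewrite /centered -/z z2; lra.
have cb (v : nat) : (2 < v <= 6)%N -> `|centered R v| <= 5.
  move=> /andP[v2 v6]; rewrite /centered -/z z2 ler_norml.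
  have : (3%:R : R) <= v%:R by rewrite ler_nat.
  have : (v%:R : R) <= 6%:R by rewrite ler_nat.
  lra.
have e1 : z ^+ 1 * (1 * expR (s * (a * centered R 1))) <= z * (1 + s * (a * - (1 - z)) + 2 * s ^+ 2).
  by rewrite expr1 mul1r ler_wpM2l ?(ltW z0) // c1 small // ler_norml; lra.
have e2 : z ^+ 2 * (1 * expR (s * (a * centered R 2))) <= (1 - z) * (1 + s * (a * z) + 2 * s ^+ 2).
  rewrite z2 mul1r ler_wpM2l //; first by lra.
  by rewrite c2 small // ler_norml; lra.
have eb (v : nat) : (2 < v <= 6)%N ->
    z ^+ v * (s ^+ 2 * expR (s * (a * centered R v))) <= z ^+ v * (s ^+ 2 * 2).
  by move=> v26; rewrite ler_wpM2l ?exprn_ge0 ?(ltW z0) // ler_wpM2l ?sqr_ge0 // big // cb.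
apply: le_trans (expR_ge1Dx _).
have := eb 3%N isT; have := eb 4%N isT; have := eb 5%N isT; have := eb 6%N isT.
rewrite !big_cons big_nil.
move: e1 e2; rewrite /= z3 z4 z5 z6.
have zs : z * z = 1 - z by rewrite -expr2.
have lin : z * (1 + s * (a * - (1 - z)) + 2 * s ^+ 2) + (1 - z) * (1 + s * (a * z) + 2 * s ^+ 2) =
  1 + 2 * s ^+ 2 by ring.
have q0 : 0 <= s ^+ 2 by rewrite sqr_ge0.
have zq : 21 / 34 * s ^+ 2 <= z * s ^+ 2 by rewrite ler_wpM2r // ltW.
move: (z ^+ 1 * _) (z ^+ 2 * _) => y1 y2.
move: (expR _) (expR _) (expR _) (expR _) => E3 E4 E5 E6.
move: (_ * (_ * E3)) (_ * (_ * E4)) (_ * (_ * E5)) (_ * (_ * E6)) lin q0 zq => w3 w4 w5 w6.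
by clear; move: (_ + _) => T; lra.
Qed.

(** Two choices of [a] matter: the constant 1 ties the multiplicity to the genus, and [i / m]
    controls the sum of [i * k_i] in the sum of the gaps. *)
Definition deviation (R : realType) (a : nat -> nat -> R) (g : nat) (H : {set 'I_(2 * g)}) : R :=
  \sum_(1 <= i < mult H) a (mult H) i * centered R (kunz H i).

Definition sparse_pred (K : nat) : gapset_pred := fun g H =>
  all (fun i => kunz H i <= 6)%N (iota 0 (mult H)) && (K * nlevel H 3 <= mult H)%N.

Lemma negligible_deviation (R : realType) (delta : R) : 0 < delta ->
  exists2 K : nat, (0 < K)%N & forall a : nat -> nat -> R,
    (forall m i, (i < m)%N -> `|a m i| <= 1) ->
    negligible R (fun g H => (g < 10 * mult H)%N &&
      (sparse_pred K H && (delta * (mult H)%:R <= deviation a H))).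
Proof.
(* With tilt [s] the exponent per coordinate is at most [4 * s ^+ 2 + 2 * s ^+ 2 - s * delta]:
   variance, repaid charges, and the deviation. [8 * s <= delta] leaves [- 2 * s ^+ 2]. *)
move=> d0; pose s : R := Num.min delta (4 / 5) / 8.
have m0 : 0 < Num.min delta (4 / 5) by rewrite lt_min d0 /=; lra.
have s0 : 0 < s by rewrite divr_gt0.
have sE : 8 * s = Num.min delta (4 / 5) by rewrite /s; field.
have sd : 8 * s <= delta by rewrite sE ge_min lexx.
have s1 : s <= 1 / 10.
  have : 8 * s <= 4 / 5 by rewrite sE ge_min lexx orbT.
  lra.
have q0 : 0 < s ^+ 2 by rewrite exprn_gt0.
have q1 : s ^+ 2 < 1 by rewrite exprn_ilt1 ?(ltW s0) //; lra.
have [be be0 beE] := power_le_expR q0 q1.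
have [K K0 HK] := exists_nat_ge (be / (2 * s ^+ 2)).
have beK : be <= K%:R * (2 * s ^+ 2) by rewrite -ler_pdivrMr // mulr_gt0.
exists K => // a a1; have c0 : 0 < 2 * s ^+ 2 by rewrite mulr_gt0.
apply: (@negligible_by_mult _ _ 1 (2 * s ^+ 2) 0) => // g m mpos.
rewrite expr0 !mul1r.
pose e (j v : nat) : R := (if (v <= 2)%N then 1 else s ^+ 2) * expR (s * (a m j * centered R v)).
pose F : R := expR (be * (m %/ K)%:R) * expR (- (s * (delta * m%:R))).
have F0 : 0 <= F by rewrite mulr_ge0 ?expR_ge0.
apply: le_trans (@count_le_msum R (fun g H => sparse_pred K H && (delta * (mult H)%:R <= deviation a H)) g m (iota 1 6) (iota 1 m.-1) e (fun=> F) _ _ _ _) _ => //.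
- by move=> j v; rewrite mulr_ge0 ?expR_ge0 //; case: ifP => // _; exact: ltW.
- move=> H HN Hm; rewrite /sparse_pred Hm => /andP[/andP[/allP k6 Kn] dev]; split.
    move=> i im; rewrite mem_iota kunz_gt0 ?Hm //= add1n ltnS k6 // mem_iota; nat_lia.
  rewrite big_split /= -expR_sum -big_distrr /=.
  have -> : \sum_(i <- iota 1 m.-1) a m i * centered R (kunz H i) = deviation a H.
    by rewrite /deviation Hm /index_iota subn1.
  rewrite (prod_if_count _ (fun j => kunz H j <= 2)%N) /F mulrACA -[leLHS]mulr1.
  rewrite beE; apply: ler_pM => //; rewrite -expRD -[leLHS]expR0 ler_expR.
    rewrite addrC -mulrBr mulr_ge0 ?(ltW be0) // subr_ge0 ler_nat leq_divRL // mulnC.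
    apply: leq_trans Kn; rewrite leq_mul2l; apply/orP; right.
    rewrite /nlevel Hm; case: (m) mpos => // m' _ /=; apply: leq_trans (leq_addl _ _).
    by apply: eq_leq; apply: eq_count => j /=; rewrite ltnNge.
  by rewrite -mulrBr mulr_ge0 ?(ltW s0) // subr_ge0.
rewrite msum_const.
apply: (@le_trans _ _ (F * expR (4 * s ^+ 2 * m%:R))).
  rewrite ler_wpM2l // mulrC expRM_natl.
  apply: (@le_trans _ _ (\prod_(j <- iota 1 m.-1) expR (4 * s ^+ 2))).
    rewrite big_seq [leRHS]big_seq; apply: ler_prod => j; rewrite mem_iota => jI.
    apply/andP; split.
      apply: sumr_ge0 => v _; rewrite mulr_ge0 ?exprn_ge0 ?golden_conj_ge0 //.
      by rewrite mulr_ge0 ?expR_ge0 //; case: ifP => // _; exact: ltW.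
    apply: tilted_total; first by rewrite (ltW s0).
    by apply: a1; nat_lia.
  rewrite big_const_seq count_predT size_iota iter_mulr_1.
  by apply: ler_weXn2l; [rewrite -[leLHS]expR0 ler_expR mulr_ge0 ?(ltW q0) | exact: leq_pred].
rewrite /F -!expRD ler_expR.
have : be * (m %/ K)%:R <= 2 * s ^+ 2 * m%:R.
  apply: (@le_trans _ _ (K%:R * (2 * s ^+ 2) * (m %/ K)%:R)); first by rewrite ler_wpM2r.
  rewrite mulrAC mulrC ler_wpM2l ?(ltW c0) // -natrM ler_nat mulnC; exact: leq_trunc_div.
have : 8 * s * (s * m%:R) <= delta * (s * m%:R) by rewrite ler_wpM2r // mulr_ge0 ?(ltW s0).
by move: (m%:R : R) => x; lra.
Qed.

Definition good_pred (R : realType) (delta : R) (K : nat) : gapset_pred := fun g H =>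
  [&& (g < 10 * mult H)%N, sparse_pred K H,
      `|deviation (fun _ _ => 1) H| <= delta * (mult H)%:R &
      `|deviation (fun m i => i%:R / m%:R) H| <= delta * (mult H)%:R].

Lemma deviationN (R : realType) (a : nat -> nat -> R) g (H : {set 'I_(2 * g)}) :
  deviation (fun m i => - a m i) H = - deviation a H.
Proof. by rewrite /deviation -sumrN; apply: eq_bigr => i _; rewrite mulNr. Qed.

Lemma negligible_abs_deviation (R : realType) (delta : R) : 0 < delta ->
  exists2 K : nat, (0 < K)%N & forall a : nat -> nat -> R,
    (forall m i, (i < m)%N -> `|a m i| <= 1) ->
    negligible R (fun g H => [&& (g < 10 * mult H)%N, sparse_pred K H &
      delta * (mult H)%:R < `|deviation a H|]).
Proof.
move=> d0; have [K K0 HK] := negligible_deviation d0; exists K => // a a1.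
have a1' m i : (i < m)%N -> `|- a m i| <= 1 by rewrite normrN; exact: a1.
apply: negligible_sub (negligible_or (HK a a1) (HK _ a1')) => g H HN /and3P[-> -> dev].
rewrite /= deviationN.
by case: (lerP 0 (deviation a H)) => sgn; move: dev;
  [rewrite ger0_norm // | rewrite ltr0_norm //] => /ltW ->; rewrite ?orbT.
Qed.

Lemma nlevel_gt6 (g : nat) (H : {set 'I_(2 * g)}) :
  all (fun i => kunz H i <= 6)%N (iota 0 (mult H)) -> nlevel H 7 = 0%N.
Proof.
move=> /allP k6; apply/eqP; rewrite -leqn0 leqNgt -has_count; apply/negP => /hasP[i iI].
by rewrite ltnNge k6.
Qed.

(** The constants [K], [K4], ..., [K7] form a ladder. If values at least 3 are frequent and no value
    exceeds 6, then at some level [q] from 3 to 6 values at least [q] are frequent while larger ones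
    are rare, because at level 7 the count is 0. *)
Lemma negligible_not_sparse (R : realType) (K : nat) : (0 < K)%N ->
  negligible R (fun g H => (g < 10 * mult H)%N && ~~ sparse_pred K H).
Proof.
move=> K0.
have [K4 K40 H3] := @negligible_cluster R 3 K isT K0.
have [K5 K50 H4] := @negligible_cluster R 4 K4 isT K40.
have [K6 K60 H5] := @negligible_cluster R 5 K5 isT K50.
have [K7 K70 H6] := @negligible_cluster R 6 K6 isT K60.
apply: negligible_sub (negligible_or (negligible_deep R)
  (negligible_or (negligible_or H3 H4) (negligible_or H5 H6))) => g H HN /andP[gm].
rewrite gm !andTb /sparse_pred /level_gap_pred.
have [hd|nd] := boolP (has _ _); first by [].
have k6 : all (fun i => kunz H i <= 6)%N (iota 0 (mult H)).
  apply/allP => i; rewrite mem_iota => im; have [-> // | i0] := posnP i.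
  rewrite leqNgt; move/hasPn: nd => /(_ i); apply; rewrite mem_iota; lia.
rewrite k6 /= -ltnNge (nlevel_gt6 k6) muln0 leq0n andbT => /ltnW ->.
have [_|/ltnW ->] := leqP (K4 * nlevel H 4) (mult H); first by [].
have [_|/ltnW ->] := leqP (K5 * nlevel H 5) (mult H); first by rewrite /= ?orbT.
have [_|/ltnW ->] := leqP (K6 * nlevel H 6) (mult H); first by rewrite /= ?orbT.
by rewrite /= ?orbT.
Qed.

Lemma negligible_not_good (R : realType) (delta : R) : 0 < delta ->
  exists2 K : nat, delta^-1 <= K%:R & negligible R (fun g H => ~~ good_pred delta K H).
Proof.
move=> d0; have [K1 K10 HK1] := negligible_abs_deviation d0.
have [K2 K20 HK2] := exists_nat_ge delta^-1.
(* [K1] serves the deviation bounds, [K2] makes the contribution of values above 2 at most of order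
   [delta]; sparsity for [K] implies it for [K1]. *)
pose K := maxn K1 K2; have K0 : (0 < K)%N by rewrite leq_max K10.
exists K; first by rewrite (le_trans HK2) // ler_nat leq_maxr.
have b1 m i : (i < m)%N -> `|1| <= 1 :> R by rewrite normr1.
have b2 m i : (i < m)%N -> `|i%:R / m%:R| <= 1 :> R.
  move=> im; have m0 : 0 < m%:R :> R by rewrite ltr0n (leq_ltn_trans _ im).
  by rewrite ger0_norm ?divr_ge0 // ler_pdivrMr // mul1r ler_nat ltnW.
apply: negligible_sub (negligible_or (negligible_small_mult R)
  (negligible_or (negligible_not_sparse R K0)
     (negligible_or (HK1 (fun _ _ => 1) b1) (HK1 _ b2)))) => g H HN.
rewrite /good_pred; have [gm|_] := ltnP g (10 * mult H); last by rewrite orTb.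
rewrite /=; have [sp|_] := boolP (sparse_pred K H); last by rewrite /= ?orbT.
have -> : sparse_pred K1 H.
  move: sp; rewrite /sparse_pred => /andP[-> sp]; rewrite /= (leq_trans _ sp) //.
  by rewrite leq_mul2r leq_maxl orbT.
by rewrite /= negb_and -!ltNge.
Qed.

(** * The weight of a good semigroup *)

(** k (k - 1) / 2 is split as (k - 1) + (k - 1) (k - 2) / 2. The last term vanishes for k = 1 and 2,
    so only the rare larger coordinates contribute non-linearly. *)
Lemma sum_progression (R : realType) (i m k : nat) :
  (\sum_(t < k) (i + t * m))%N%:R =
  i%:R * k%:R + m%:R * (k%:R - 1) + m%:R * ((k%:R - 1) * (k%:R - 2) / 2) :> R.
Proof.
elim: k => [|k IH]; first by rewrite big_ord0; field.
by rewrite big_ord_recr /= natrD IH natrD natrM -[k.+1]addn1 natrD; field.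
Qed.

Lemma excess_bounds (R : realType) (k : nat) : (0 < k <= 6)%N ->
  0 <= ((k%:R : R) - 1) * (k%:R - 2) / 2 <= 10 * (2 < k)%N%:R.
Proof.
move=> /andP[k0 k6].
have : k = 1%N \/ k = 2%N \/ k = 3%N \/ k = 4%N \/ k = 5%N \/ k = 6%N by lia.
by case=> [->|[->|[->|[->|[->|->]]]]] /=; lra.
Qed.

Lemma sum_index (R : realType) (m : nat) : (0 < m)%N ->
  \sum_(1 <= i < m) i%:R = m%:R * (m%:R - 1) / 2 :> R.
Proof.
case: m => // m _; elim: m => [|m IH]; first by rewrite big_geq //; field.
by rewrite big_nat_recr //= IH -[m.+2]addn1 natrD; field.
Qed.

Lemma deviation_const (R : realType) (g : nat) (H : {set 'I_(2 * g)}) : H \in NS g ->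
  deviation (fun _ _ => 1) H =
  g%:R - ((mult H)%:R - 1) * (1 + golden_conj R ^+ 2) :> R.
Proof.
move=> HN; rewrite /deviation.
have -> : g%:R = \sum_(1 <= i < mult H) (kunz H i)%:R :> R by rewrite -natr_sum sum_kunz.
have -> : ((mult H)%:R - 1) * (1 + golden_conj R ^+ 2) =
    \sum_(1 <= i < mult H) (1 + golden_conj R ^+ 2) :> R.
  by rewrite sumr_const_nat -[RHS]mulr_natl natrB.
rewrite -sumrB; apply: eq_bigr => i _; rewrite mul1r /centered; ring.
Qed.

Lemma deviation_linear (R : realType) (g : nat) (H : {set 'I_(2 * g)}) (m := (mult H)%:R : R) :
  m * deviation (fun m i => i%:R / m%:R) H =
  \sum_(1 <= i < mult H) i%:R * (kunz H i)%:R - (1 + golden_conj R ^+ 2) * (m * (m - 1) / 2).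
Proof.
have m0 : m != 0 by rewrite pnatr_eq0.
rewrite -(sum_index R (mult_gt0 H)) /deviation !big_distrr /= -sumrB.
by apply: eq_bigr => i _; rewrite /centered -/m; field.
Qed.

Lemma sum_gaps_estimate (R : realType) (g K : nat) (H : {set 'I_(2 * g)}) (m := (mult H)%:R : R) :
  H \in NS g -> sparse_pred K H ->
  exists2 E : R, 0 <= K%:R * E <= 10 * m &
  (\sum_(x in H) nat_of_ord x)%:R =
    m * deviation (fun m i => i%:R / m%:R) H + (1 + golden_conj R ^+ 2) * (m * (m - 1) / 2) +
    m * (g%:R - (m - 1)) + m * E.
Proof.
move=> HN /andP[/allP k6 Kn].
pose E : R := \sum_(1 <= i < mult H) ((kunz H i)%:R - 1) * ((kunz H i)%:R - 2) / 2.
have kb i : (0 < i < mult H)%N -> (0 < kunz H i <= 6)%N.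
  by move=> /andP[i0 im]; rewrite kunz_gt0 ?i0 //= k6 // mem_iota.
have E0 : 0 <= E.
  rewrite /E big_nat_cond; apply: sumr_ge0 => i /andP[im _].
  by have /andP[] := excess_bounds R (kb i im).
have E1 : E <= 10 * (nlevel H 3)%:R.
  apply: (@le_trans _ _ (\sum_(1 <= i < mult H) 10 * (2 < kunz H i)%N%:R)).
    rewrite /E big_nat_cond [leRHS]big_nat_cond; apply: ler_sum => i /andP[im _].
    by have /andP[] := excess_bounds R (kb i im).
  rewrite -big_distrr /= ler_wpM2l // -natr_sum ler_nat -big_mkcond /= sum1_count.
  rewrite /nlevel -{2}[mult H]prednK // /index_iota subn1.
  by rewrite -[iota 0 _]/(0%N :: iota 1 (mult H).-1) /= leq_addl.
exists E.
  rewrite mulr_ge0 //=; apply: (@le_trans _ _ (K%:R * (10 * (nlevel H 3)%:R))).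
    by rewrite ler_wpM2l.
  by rewrite mulrCA ler_wpM2l // -natrM ler_nat.
rewrite (sum_over_gaps (fun x => x) (mult_gt0 H) (fun n => isgap_divn n HN) (kunz0 H)).
rewrite natr_sum (eq_bigr _ (fun i _ => sum_progression R i (mult H) (kunz H i))).
rewrite !big_split /= -!big_distrr /= -/E -/m deviation_linear subrK -/m.
congr (_ + _ * _ + _).
rewrite sumrB -natr_sum sum_kunz // sumr_const_nat natrB //.
Qed.

Lemma quadratic_estimate (R : realFieldType) (z g m D1 D2 E delta : R) :
  z ^+ 2 = 1 - z -> 21 / 34 < z < 34 / 55 -> 0 <= delta -> 1 <= g -> 0 <= m -> m <= 2 * g ->
  D1 = g - (m - 1) * (1 + z ^+ 2) -> `|D1| <= delta * m -> `|D2| <= delta * m ->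
  0 <= E <= 10 * delta * m ->
  `|m * D2 + (1 + z ^+ 2) * (m * (m - 1) / 2) + m * (g - (m - 1)) + m * E
    - g * (g + 1) / 2 - z / 10 * g ^+ 2| <= 48 * delta * g ^+ 2 + 7 * g.
Proof.
move=> zz /andP[zl zh] d0 g1 m0 mg D1E D1b D2b /andP[E0 E1].
have g0 : 0 <= g by lra.
have dmg : delta * m <= delta * (2 * g) by rewrite ler_wpM2l.
have mm : m * (delta * m) <= 2 * g * (delta * (2 * g)) by apply: ler_pM; rewrite ?mulr_ge0.
have t1 : `|m * D2| <= 4 * delta * g ^+ 2.
  rewrite normrM (ger0_norm m0); apply: le_trans (ler_wpM2l m0 D2b) _; lra.
have t2 : `|m * E| <= 40 * delta * g ^+ 2.
  rewrite normrM (ger0_norm m0) (ger0_norm E0).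
  have : m * E <= m * (10 * delta * m) by rewrite ler_wpM2l.
  lra.
(* [a = 1 + z ^+ 2] is the mean of a coordinate, and [r] measures the error in the approximation of
   [m] by [g / a]. *)
pose a := 2 - z; pose r := a * m - g.
have rE : r = a - D1 by rewrite /r /a D1E zz; ring.
have rb : `|r| <= 2 + 2 * delta * g.
  rewrite rE; apply: le_trans (ler_normB _ _) _.
  by apply: lerD; [rewrite ger0_norm /a; lra | lra].
have r2g : `|r| <= 2 * g.
  have h1 : 0 <= a * m by rewrite mulr_ge0 // /a; lra.
  have h2 : a * m <= 3 / 2 * (2 * g) by apply: ler_pM => //; rewrite /a; lra.
  by rewrite ler_norml /r; lra.
pose X := m * g - z * m ^+ 2 / 2 - g ^+ 2 / 2 - z / 10 * g ^+ 2.
have aX : a ^+ 2 * X = r * (a * g - z * g - z * r / 2).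
  have z3 : z ^+ 3 = 2 * z - 1 by rewrite exprS zz mulrBr -expr2 zz; ring.
  have -> : r * (a * g - z * g - z * r / 2) = a ^+ 2 * (m * g - z * m ^+ 2 / 2) - (a - z / 2) * g ^+ 2.
    by rewrite /r; field.
  (* The origin of the constant 1/10: at [m = g / a] the leading part vanishes exactly by this
     identity, in which [a ^+ 2 = 5 * (1 - z)]. *)
  have -> : a - z / 2 = a ^+ 2 * (1 / 2 + z / 10) by rewrite /a; lra.
  by rewrite /X; ring.
have Xb : `|X| <= 4 * g + 4 * delta * g ^+ 2.
  have a1 : 1 <= a ^+ 2 by rewrite expr_ge1 // /a; lra.
  apply: (@le_trans _ _ (a ^+ 2 * `|X|)); first by rewrite ler_peMl.
  rewrite -[a ^+ 2]ger0_norm ?sqr_ge0 // -normrM aX normrM.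
  have h : `|a * g - z * g - z * r / 2| <= 2 * g.
    apply: le_trans (ler_normB _ _) _.
    have h1 : `|a * g - z * g| <= 1 * g.
      by rewrite -mulrBl normrM (ger0_norm g0) ler_wpM2r // ger0_norm /a; lra.
    have h2 : `|z * r / 2| <= 1 * (2 * g) / 2.
      rewrite normrM [X in _ * X <= _]ger0_norm ?invr_ge0 // ler_wpM2r ?invr_ge0 // normrM.
      by apply: ler_pM => //; rewrite ger0_norm; lra.
    lra.
  apply: le_trans (ler_pM _ _ rb h) _ => //; lra.
have -> : m * D2 + (1 + z ^+ 2) * (m * (m - 1) / 2) + m * (g - (m - 1)) + m * E
    - g * (g + 1) / 2 - z / 10 * g ^+ 2 = X + (m * (z / 2) - g / 2) + m * D2 + m * E.
  by rewrite /X zz; field.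
have t3 : `|m * (z / 2) - g / 2| <= 3 * g.
  have h1 : 0 <= m * (z / 2) by rewrite mulr_ge0 //; lra.
  have h2 : m * (z / 2) <= 2 * g * 1 by apply: ler_pM => //; lra.
  by rewrite ler_norml; lra.
have : `|X + (m * (z / 2) - g / 2) + m * D2 + m * E| <=
    `|X| + `|m * (z / 2) - g / 2| + `|m * D2| + `|m * E|.
  by apply: le_trans (ler_normD _ _) _; rewrite lerD2r; apply: le_trans (ler_normD _ _) _; rewrite lerD2r ler_normD.
(* 48 = 4 + 4 + 40 from [X], [D2] and [E]; 7 = 4 + 3 from [X] and the linear terms. *)
by move=> h; apply: le_trans h _; lra.
Qed.

(** Truncation at 0 can only bring the difference closer to a nonnegative target, so the subtraction
    in [weight] may be treated as one in the field. *)
Lemma subn_estimate (R : realDomainType) (S G : nat) (L : R) : 0 <= L ->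
  `|(S - G)%N%:R - L| <= `|S%:R - G%:R - L|.
Proof.
move=> L0; have [GS|/ltnW SG] := leqP G S; first by rewrite natrB.
have : (S%:R : R) <= G%:R by rewrite ler_nat.
move: (SG); rewrite -subn_eq0 => /eqP -> h.
rewrite sub0r normrN ger0_norm // ler0_norm; lra.
Qed.

Lemma half_prod_succ (R : realFieldType) (g : nat) :
  ((g * g.+1) %/ 2)%N%:R = g%:R * (g%:R + 1) / 2 :> R.
Proof.
have e : (((g * g.+1) %/ 2) * 2 = g * g.+1)%N by rewrite divnK // dvdn2 oddM /=; case: odd.
have : (((g * g.+1) %/ 2) * 2)%N%:R = (g * g.+1)%N%:R :> R by rewrite e.
rewrite !natrM -[g.+1]addn1 natrD => h; lra.
Qed.

Lemma weight_estimate (R : realType) (delta : R) (K g : nat) (H : {set 'I_(2 * g)}) :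
  0 < delta -> delta^-1 <= K%:R -> (0 < g)%N -> H \in NS g -> good_pred delta K H ->
  `|(weight H)%:R - golden_conj R / 10 * g%:R ^+ 2| <= 48 * delta * g%:R ^+ 2 + 7 * g%:R.
Proof.
move=> d0 dK g0 HN /and4P[_ sp D1 D2].
have [E /andP[E0 E1] SE] := sum_gaps_estimate R HN sp.
have z0 := golden_conj_ge0 R.
apply: le_trans (subn_estimate _ _ _) _; first by apply: mulr_ge0; rewrite ?exprn_ge0 // divr_ge0.
rewrite SE half_prod_succ.
have K0 : 0 < K%:R :> R by apply: lt_le_trans dK; rewrite invr_gt0.
have E'0 : 0 <= E by rewrite -(pmulr_rge0 _ K0).
apply: (@quadratic_estimate R _ _ _ (deviation (fun _ _ => 1) H)) => //.
- exact: golden_conj_sqr.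
- exact: golden_conj_bounds.
- exact: ltW.
- by rewrite ler1n.
- rewrite -natrM ler_nat; apply: leq_trans (mult_le HN) _; nat_lia.
- exact: deviation_const HN.
(* [K * delta >= 1] turns the sparsity bound [K * E <= 10 * m] into [E <= 10 * delta * m]. *)
- rewrite E'0 /= -(ler_pM2l K0); apply: le_trans E1 _.
  have : 1 <= K%:R * delta by rewrite -ler_pdivrMr // div1r.
  move=> h; have : 10 * (mult H)%:R * 1 <= 10 * (mult H)%:R * (K%:R * delta).
    by rewrite ler_wpM2l ?mulr_ge0.
  lra.
Qed.

Lemma weight_le (g : nat) (H : {set 'I_(2 * g)}) : H \in NS g -> (weight H <= 2 * g ^ 2)%N.
Proof.
rewrite in_set => /andP[/eqP cH _]; apply: leq_trans (leq_subr _ _) _.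
apply: (@leq_trans (\sum_(x in H) 2 * g)); first by apply: leq_sum => x _; exact: ltnW.
by rewrite sum_nat_const cH mulnCA mulnn.
Qed.

(** * Passage to the expectation *)

(** After scaling by z^g the family has size at most [C * expR (- (c * g))] while [NS g] has at
    least z, from compositions; [1 + c * g <= expR (c * g)] yields an explicit [N]. *)
Lemma negligible_fraction (R : realType) (P : gapset_pred) (eps : R) :
  negligible R P -> 0 < eps ->
  exists N : nat, forall g, (N <= g)%N -> #|[set H in NS g | P g H]|%:R <= eps * #|NS g|%:R.
Proof.
move=> [C [c [C0 c0 HP]]] e0; have z0 := golden_conj_gt0 R.
have [N _ HN] := exists_nat_ge (C / (golden_conj R * eps) / c).
exists N => g Ng; have zg : 0 < golden_conj R ^+ g by rewrite exprn_gt0.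
rewrite -(ler_pM2l zg) mulrCA; apply: le_trans (HP g) _.
apply: (@le_trans _ _ (eps * golden_conj R)); last first.
  rewrite ler_wpM2l ?(ltW e0) //; apply: le_trans (size_comps_ge R g) _.
  by rewrite ler_wpM2l ?(ltW zg) // ler_nat card_NS_ge.
rewrite expRN ler_pdivrMr ?expR_gt0 //.
apply: (@le_trans _ _ (eps * golden_conj R * (1 + c * g%:R))); last first.
  by rewrite ler_wpM2l ?expR_ge1Dx // mulr_ge0 // ltW.
have ez0 : 0 < eps * golden_conj R by rewrite mulr_gt0.
have : C / (golden_conj R * eps) / c <= g%:R by rewrite (le_trans HN) // ler_nat.
rewrite ler_pdivrMr // (ler_pdivrMr _ _ (mulr_gt0 z0 e0)) => h; apply: le_trans h _.
have -> : g%:R * c * (golden_conj R * eps) = eps * golden_conj R * (c * g%:R) by ring.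
by rewrite ler_wpM2l ?(ltW ez0) // lerDr.
Qed.

Lemma weight_sqr_estimate (R : realType) (eps delta : R) (K g : nat) (H : {set 'I_(2 * g)}) :
  0 < delta -> 600 * delta <= eps -> delta^-1 <= K%:R -> (0 < g)%N -> 168 <= eps * g%:R ->
  H \in NS g ->
  `|(weight H)%:R ^+ 2 / g%:R ^+ 4 - (golden_conj R / 10) ^+ 2| <=
    eps / 2 + 4 * (~~ good_pred delta K H)%:R.
Proof.
move=> d0 de dK g0 ge HN; have g1 : 0 < g%:R :> R by rewrite ltr0n.
have gn : g%:R != 0 :> R by rewrite gt_eqF.
have z0 := golden_conj_gt0 R; have /andP[_ zh] := golden_conj_bounds R.
pose x : R := (weight H)%:R / g%:R ^+ 2; pose y := golden_conj R / 10.
have -> : (weight H)%:R ^+ 2 / g%:R ^+ 4 = x ^+ 2 by rewrite /x expr_div_n -exprM.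
rewrite -/y; have y01 : 0 <= y <= 1 by rewrite /y; apply/andP; split; lra.
have x02 : 0 <= x <= 2.
  rewrite divr_ge0 ?exprn_ge0 //= ler_pdivrMr ?exprn_gt0 // -natrX -natrM ler_nat.
  exact: weight_le.
have e0 : 0 <= eps by lra.
move: y01 x02 => /andP[y0 y1] /andP[x0 x2].
have [gd|bd] := boolP (good_pred delta K H); last first.
  rewrite mulr1; apply: (@le_trans _ _ 4); last by rewrite lerDr divr_ge0.
  have : 0 <= x ^+ 2 <= 2 ^+ 2 by rewrite exprn_ge0 //= lerXn2r ?nnegrE.
  have : 0 <= y ^+ 2 <= 1 by rewrite exprn_ge0 //= exprn_ile1.
  by rewrite ler_norml => /andP[a b] /andP[c d]; apply/andP; split; lra.
rewrite mulr0 addr0.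
have xy : `|x - y| <= 48 * delta + 7 / g%:R.
  have g20 : 0 < g%:R ^+ 2 :> R by rewrite exprn_gt0.
  rewrite -(ler_pM2r g20) -[X in _ * X <= _](gtr0_norm g20) -normrM.
  apply: le_trans (le_trans _ (weight_estimate d0 dK g0 HN gd)) _.
    by rewrite le_eqVlt; apply/orP; left; apply/eqP; congr (`|_|); rewrite /x /y; field.
  by rewrite le_eqVlt; apply/orP; left; apply/eqP; field.
have ge' : 7 / g%:R <= eps / 24.
  by rewrite ler_pdivrMr //; lra.
(* 3 bounds [x + y]. With [delta <= eps / 600] and [7 / g <= eps / 24] (hence 168 = 7 * 24) the
   product is below [eps / 2]. *)
rewrite subr_sqr normrM; apply: (@le_trans _ _ ((48 * delta + 7 / g%:R) * 3)).
  by apply: ler_pM => //; rewrite ger0_norm ?addr_ge0 //; lra.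
lra.
Qed.

Lemma second_moment_limit (R : realType) (eps : R) : 0 < eps ->
  exists N : nat, forall g, (N <= g)%N ->
  `|(\sum_(H in NS g) weight H ^ 2)%N%:R / #|NS g|%:R / g%:R ^+ 4 - (golden_conj R / 10) ^+ 2| < eps.
Proof.
move=> e0; pose delta : R := eps / 600.
have d0 : 0 < delta by rewrite divr_gt0.
have [K dK bad] := negligible_not_good d0.
(* A bad semigroup contributes at most 4 beyond [eps / 2], so a bad fraction of [eps / 16] adds
   [eps / 4]. *)
have e16 : 0 < eps / 16 by rewrite divr_gt0.
have [N1 HN1] := negligible_fraction bad e16.
have [N2 N20 HN2] := exists_nat_ge (168 / eps).
exists (maxn N1 N2) => g; rewrite geq_max => /andP[gN1 gN2].
have g0 : (0 < g)%N by apply: leq_trans gN2.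
have g1 : 0 < g%:R :> R by rewrite ltr0n.
have gn : g%:R != 0 :> R by rewrite gt_eqF.
have n0 : 0 < #|NS g|%:R :> R.
  rewrite ltr0n (leq_trans _ (card_NS_ge g)) // -(ltr0n R).
  have := size_comps_ge R g; have z0 := golden_conj_gt0 R.
  rewrite lt0r ler0n andbT; apply: contraTneq => ->; rewrite mulr0 -ltNge //.
have nn : #|NS g|%:R != 0 :> R by rewrite gt_eqF.
have ge : 168 <= eps * g%:R.
  by rewrite mulrC -ler_pdivrMr // (le_trans HN2) // ler_nat.
have -> : (\sum_(H in NS g) weight H ^ 2)%N%:R / #|NS g|%:R / g%:R ^+ 4 - (golden_conj R / 10) ^+ 2 =
    (\sum_(H in NS g) ((weight H)%:R ^+ 2 / g%:R ^+ 4 - (golden_conj R / 10) ^+ 2)) / #|NS g|%:R.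
  rewrite sumrB sumr_const -big_distrl /= natr_sum mulrBl -[X in _ - X / _]mulr_natr mulfK //.
  by rewrite mulrAC; congr (_ / _ / _ - _); apply: eq_bigr => H _; rewrite natrX.
rewrite normrM normfV (gtr0_norm n0) ltr_pdivrMr //.
apply: le_lt_trans (ler_norm_sum _ _ _) _.
have d600 : 600 * delta <= eps by rewrite (_ : 600 * delta = eps) // /delta; field.
apply: le_lt_trans (ler_sum _ (fun H HN => weight_sqr_estimate d0 d600 dK g0 ge HN)) _.
rewrite big_split /= sumr_const -[X in X + _]mulr_natr -big_distrr /= -natr_sum.
have -> : (\sum_(H in NS g) ~~ good_pred delta K H)%N = #|[set H in NS g | ~~ good_pred delta K H]|.
  rewrite -sum1_card [LHS]big_mkcond [RHS]big_mkcond /=; apply: eq_bigr => H _.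
  by rewrite in_NS; case: (H \in NS g); case: good_pred.
have := HN1 g gN1; move: (#|_|%:R) n0 => n n0; move: (#|_|%:R) => b h.
have : 0 < eps * n by rewrite mulr_gt0.
lra.
Qed.

Local Close Scope ring_scope.

Lemma golden_conj_inv (F : rcfType) : (1 / (10 * ((1 + Num.sqrt 5) / 2)) = golden_conj F / 10)%R.
Proof.
have s2 : (Num.sqrt (5 : F) ^+ 2 = 5)%R by rewrite sqr_sqrtr.
have : (0 <= Num.sqrt (5 : F))%R by rewrite sqrtr_ge0.
rewrite /golden_conj; move: (Num.sqrt (5 : F)) s2 => s s2 s0.
have s1 : (10 * ((1 + s) / 2) != 0)%R by apply: lt0r_neq0; lra.
apply: (mulfI s1); rewrite mul1r divff //; lra.
Qed.

Lemma inv_phi : Rdiv 1 (Rmult 10 phi) = (golden_conj R / 10)%R.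
Proof.
have n (p : positive) : IZR (Z.pos p) = (nat_of_pos p)%:R%R by rewrite IZRposE INRE.
have sE : sqrt 5 = Num.sqrt (5%:R : R)%R by rewrite RsqrtE n.
rewrite /phi sE /golden_conj !RdivE !RmultE RplusE !n /=.
exact: golden_conj_inv.
Qed.

Open Scope R_scope.

Theorem theorem7p1 :
  Un_cv (fun g : nat => Ew2 g / (INR g) ^ 4) ((1 / (10 * phi)) ^ 2).
Proof.
move=> eps /RltP e0; have [N HN] := @second_moment_limit R eps e0; exists N => g gN.
have := HN g (introT ssrnat.leP gN).
rewrite RdistE RpowE INRE inv_phi /Ew2 !RdivE !INRE RpowE => h; exact/RltP.
Qed.
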